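(* Let $K,L$ be étale $\mathbb Q$-algebras and let $R$ and $S$ be sieves for $K$ and $L$, respectively. Let $A:\mathcal O_K\to\mathcal O_L$ be a $\mathbb Z$-linear map; for each prime number $p$ denote also by $A$ the induced $\mathbb Z_p$-linear map $\mathcal O_{K,p}\to\mathcal O_{L,p}$. Assume that there are infinitely many prime numbers $p$ satisfying all of the following conditions: (a) $A(V_p(K,R))\subseteq V_p(L,S)$. (b) $A(\mathcal O_K)\cap S_{\mathfrak q}\ne\emptyset$ for all primes $\mathfrak q\mid p$ of $L$. (c) $\sum_{\mathfrak p\mid p\text{ prime of }K}\operatorname{meas}(R_{\mathfrak p})<1$. (d) $p$ splits completely in both $K$ and $L$. Then $A$ is the composition $M_\varepsilon\circ\tau$ of (the restriction to $\mathcal O_K$ of) a $\mathbb Q$-algebra homomorphism $\tau:K\to L$ and the multiplication map $M_\varepsilon:\mathcal O_L\to\mathcal O_L$, $x\mapsto\varepsilon x$, for some $\varepsilon\in\mathcal O_L$.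
   Context: An étale $\mathbb Q$-algebra is a cartesian product $K=K_1\times\cdots\times K_r$ ($r\ge1$) of finitely many number fields; its ring of integers is $\mathcal O_K=\prod_i\mathcal O_{K_i}$. A prime $\mathfrak p$ of $K$ is a maximal ideal of $\mathcal O_K$ (i.e. a nonzero prime ideal in one factor times the full ring in the other factors). $\mathcal O_{K,\mathfrak p}$ is the $\mathfrak p$-adic completion of $\mathcal O_K$, carrying the Haar measure $\operatorname{meas}$ normalized by $\operatorname{meas}(\mathcal O_{K,\mathfrak p})=1$. For a prime number $p$, $\mathcal O_{K,p}=\mathcal O_K\otimes_{\mathbb Z}\mathbb Z_p$, identified with $\prod_{\mathfrak p\mid p}\mathcal O_{K,\mathfrak p}$. Elements of $\mathcal O_K$ are viewed in $\mathcal O_{K,\mathfrak p}$ and $\mathcal O_{K,p}$ via the natural maps. A sieve for $K$ is a collection $R=(R_{\mathfrak p})_{\mathfrak p}$ of compact open subsets $R_{\mathfrak p}\subseteq\mathcal O_{K,\mathfrak p}$ (possibly empty or everything), one for each prime $\mathfrak p$ of $K$; and $V_p(K,R)=\prod_{\mathfrak p\mid p}(\mathcal O_{K,\mathfrak p}\setminus R_{\mathfrak p})\subseteq\mathcal O_{K,p}$. A prime number $p$ splits completely in $K$ if $K\otimes_{\mathbb Q}\mathbb Q_p\cong\mathbb Q_p^n$ as $\mathbb Q_p$-algebras, where $n=\dim_{\mathbb Q}K$. *)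

(* Defs.v *)
From HB Require Import structures.
From mathcomp Require Import all_boot all_order all_algebra all_field.
From mathcomp Require Import generic_quotient ring_quotient fraction.
From mathcomp Require Import all_classical all_reals all_analysis.
From mathcomp Require Import ring zify.

Set Implicit Arguments.
Unset Strict Implicit.
Unset Printing Implicit Defensive.

Import GRing.Theory Num.Theory.
Import Quotient.

Local Open Scope classical_set_scope.
Local Open Scope quotient_scope.
Local Open Scope ring_scope.

Section IdealPower.
Variable A : comNzRingType.

Definition ideal_mul (I J : {pred A}) : {pred A} := fun x =>
  `[< exists s : seq (A * A),
        {in s, forall ab, (ab.1 \in I) && (ab.2 \in J)}
        /\ x = \sum_(ab <- s) ab.1 * ab.2 >].

Definition ideal_pow (I : {pred A}) (n : nat) : {pred A} :=
  iter n (ideal_mul I) predT.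

Lemma ideal_mulP (I J : {pred A}) x :
  reflect (exists s : seq (A * A),
        {in s, forall ab, (ab.1 \in I) && (ab.2 \in J)}
        /\ x = \sum_(ab <- s) ab.1 * ab.2) (x \in ideal_mul I J).
Proof. exact: asboolP. Qed.

Lemma ideal_pow_0 (I : {pred A}) n : 0 \in ideal_pow I n.
Proof.
case: n => [//|n]; apply/ideal_mulP; exists [::].
by split=> //; rewrite big_nil.
Qed.

Lemma ideal_pow_add (I : {pred A}) n x y :
  x \in ideal_pow I n -> y \in ideal_pow I n -> x + y \in ideal_pow I n.
Proof.
case: n => [//|n] /ideal_mulP [s [hs ->]] /ideal_mulP [t [ht ->]].
apply/ideal_mulP; exists (s ++ t); split; last by rewrite big_cat.
by move=> ab; rewrite mem_cat => /orP[/hs|/ht].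
Qed.

Lemma ideal_pow_mul (I : {pred A}) n a x :
  x \in ideal_pow I n -> a * x \in ideal_pow I n.
Proof.
elim: n a x => [//|n IH] a x /ideal_mulP [s [hs ->]].
apply/ideal_mulP; exists [seq (ab.1, a * ab.2) | ab <- s]; split.
  by move=> _ /mapP[ab /hs /andP[h1 h2] ->] /=; rewrite h1 IH.
by rewrite big_map mulr_sumr; apply: eq_bigr => ab _; rewrite /= mulrCA.
Qed.

Lemma ideal_pow_sub (I : {pred A}) n x y :
  x \in ideal_pow I n -> y \in ideal_pow I n -> x - y \in ideal_pow I n.
Proof.
by move=> hx hy; rewrite -mulN1r ideal_pow_add // ideal_pow_mul.
Qed.

Lemma ideal_pow1 (I : idealr A) : {subset ideal_pow I 1 <= I}.
Proof.
move=> x /ideal_mulP [s [hs ->]]; rewrite big_seq.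
by apply: rpred_sum => ab /hs /andP[h _]; rewrite mulrC idealMr.
Qed.

End IdealPower.

Lemma ideal_pow_morph (A B : comNzRingType) (f : {rmorphism A -> B})
    (I : {pred A}) (J : {pred B}) n x :
  {in I, forall x, f x \in J} ->
  x \in ideal_pow I n -> f x \in ideal_pow J n.
Proof.
move=> fIJ; elim: n x => [//|n IH] x /ideal_mulP [s [hs ->]].
apply/ideal_mulP; exists [seq (f ab.1, f ab.2) | ab <- s]; split.
  by move=> _ /mapP[ab /hs /andP[/fIJ h1 /IH h2] ->] /=; rewrite h1.
by rewrite big_map rmorph_sum; apply: eq_bigr => ab _; rewrite rmorphM.
Qed.

Section Completion.
Variables (A : comNzRingType) (I : idealr A).

(* The completion [lim_n A / I^n] is the ring of sequences [x] of [A] with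
   [x n.+1 = x n] modulo [I ^ n], modulo the ideal of the sequences with
   [x n = 0] modulo [I ^ n] for all [n]; the class of [x] is the compatible
   family [(x n mod I ^ n)_n]. *)
Definition coherent : {pred nat -> A} := fun x =>
  `[< forall n, x n.+1 - x n \in ideal_pow I n >].

Lemma coherentP x :
  reflect (forall n, x n.+1 - x n \in ideal_pow I n) (x \in coherent).
Proof. exact: asboolP. Qed.

Lemma coherent_subring : subring_closed coherent.
Proof.
split=> [|x y /coherentP hx /coherentP hy|x y /coherentP hx /coherentP hy];
  apply/coherentP=> n.
- by rewrite subrr ideal_pow_0.
- have -> : (x - y) n.+1 - (x - y) n = (x n.+1 - x n) - (y n.+1 - y n).
    by rewrite -[(x - y) n.+1]/(x n.+1 - y n.+1) -[(x - y) n]/(x n - y n); ring.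
  exact: ideal_pow_sub.
have -> : (x * y) n.+1 - (x * y) n
        = x n.+1 * (y n.+1 - y n) + y n * (x n.+1 - x n).
  by rewrite -[(x * y) n.+1]/(x n.+1 * y n.+1) -[(x * y) n]/(x n * y n); ring.
by rewrite ideal_pow_add ?ideal_pow_mul.
Qed.

HB.instance Definition _ :=
  GRing.isSubringClosed.Build (nat -> A) coherent coherent_subring.

Record coherent_seq := CoherentSeq {
  coherent_val :> nat -> A;
  coherent_valP : coherent_val \in coherent }.

HB.instance Definition _ := [isSub for coherent_val].
HB.instance Definition _ := [Choice of coherent_seq by <:].
HB.instance Definition _ := [SubChoice_isSubComNzRing of coherent_seq by <:].

Definition null_seq : {pred coherent_seq} := fun x =>
  `[< forall n, x n \in ideal_pow I n >].

Lemma null_seqP (x : coherent_seq) :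
  reflect (forall n, x n \in ideal_pow I n) (x \in null_seq).
Proof. exact: asboolP. Qed.

Lemma null_seq_ideal : idealr_closed null_seq.
Proof.
split.
- by apply/null_seqP => n; rewrite ideal_pow_0.
- apply/negP => /null_seqP /(_ 1%N) /ideal_pow1.
  by rewrite -[coherent_val 1 1%N]/(1 : A) idealr1.
- move=> a x y /null_seqP hx /null_seqP hy; apply/null_seqP => n.
  by rewrite -[coherent_val _ n]/(a n * x n + y n) ideal_pow_add ?ideal_pow_mul.
Qed.

HB.instance Definition _ :=
  isIdealr.Build coherent_seq null_seq null_seq_ideal.

Definition completion : Type := {ideal_quot null_seq}.

HB.instance Definition _ := GRing.ComNzRing.on completion.
HB.instance Definition _ := isPointed.Build completion 0.

Lemma const_coherent (a : A) : (fun _ : nat => a) \in coherent.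
Proof. by apply/coherentP => n; rewrite subrr ideal_pow_0. Qed.

Definition completion_of (a : A) : completion :=
  \pi_({ideal_quot null_seq}) (CoherentSeq (const_coherent a)).

Lemma completion_of_zmod_morphism : zmod_morphism completion_of.
Proof. by move=> a b; rewrite /completion_of -rmorphB; congr (\pi_(_) _); exact: val_inj. Qed.

Lemma completion_of_monoid_morphism : monoid_morphism completion_of.
Proof.
split=> [|a b]; last first.
  by rewrite /completion_of -rmorphM; congr (\pi_(_) _); exact: val_inj.
rewrite -[RHS](rmorph1 (\pi_({ideal_quot null_seq}))).
by congr (\pi_(_) _); exact: val_inj.
Qed.

HB.instance Definition _ := GRing.isZmodMorphism.Build A completion
  completion_of completion_of_zmod_morphism.
HB.instance Definition _ := GRing.isMonoidMorphism.Build A completion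
  completion_of completion_of_monoid_morphism.

(* The inverse limit topology, i.e. the [I]-adic one: the open sets are the
   unions of fibres of the projections to the quotients [A / I ^ n]. *)
Definition completion_ball (x : completion) (n : nat) : set completion :=
  [set y | (repr y : coherent_seq) n - (repr x : coherent_seq) n
             \in ideal_pow I n].

Definition completion_open : set (set completion) :=
  [set U | forall x, U x -> exists n, completion_ball x n `<=` U].

Lemma ideal_powS n : {subset ideal_pow I n.+1 <= ideal_pow I n}.
Proof.
elim: n => [//|n IH] x /ideal_mulP [s [hs ->]]; apply/ideal_mulP.
by exists s; split=> // ab /hs /andP[-> /IH].
Qed.

Lemma completion_ballS x n : completion_ball x n.+1 `<=` completion_ball x n.
Proof.
move=> y; rewrite /completion_ball /=.
set u := repr y; set v := repr x => /ideal_powS h.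
have /coherentP /(_ n) hu := coherent_valP u.
have /coherentP /(_ n) hv := coherent_valP v.
have -> : (u : coherent_seq) n - (v : coherent_seq) n
  = ((u : coherent_seq) n.+1 - (v : coherent_seq) n.+1
      + ((v : coherent_seq) n.+1 - (v : coherent_seq) n))
     - ((u : coherent_seq) n.+1 - (u : coherent_seq) n).
  by ring.
by apply: ideal_pow_sub => //; apply: ideal_pow_add.
Qed.

Lemma completion_ball_le x m n :
  (m <= n)%N -> completion_ball x n `<=` completion_ball x m.
Proof.
move=> /subnK <-; elim: (n - m)%N => [|k IH] y; first by rewrite add0n.
by rewrite addSn => /completion_ballS /IH.
Qed.

Lemma completion_openT : completion_open setT.
Proof. by move=> x _; exists 0%N. Qed.

Lemma completion_openI : setI_closed completion_open.
Proof.
move=> U V oU oV x [/oU [m hm] /oV [n hn]]; exists (maxn m n) => y hy; split.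
  by apply/hm/(completion_ball_le _ hy)/leq_maxl.
by apply/hn/(completion_ball_le _ hy)/leq_maxr.
Qed.

Lemma completion_open_bigU (J : Type) (f : J -> set completion) :
  (forall i, completion_open (f i)) -> completion_open (\bigcup_i f i).
Proof.
move=> of_ x [i _ /of_ [n hn]]; exists n => y /hn; exists i => //.
Qed.

HB.instance Definition _ := isOpenTopological.Build completion
  completion_openT completion_openI completion_open_bigU.

Definition borel_completion := g_sigma_algebraType (@open completion).

(* [completion I] is only used for compact completions, on which the normalized
   Haar measure is the unique translation invariant Borel probability. *)
Definition haar (RT : realType) (mu : probability borel_completion RT) : Prop :=
  forall (x : completion) (U : set completion),
    (measurable : set (set borel_completion)) U ->
    mu [set x + y | y in U] = mu U.

End Completion.

Section CompletionMap.
Variables (A B : comNzRingType) (I : idealr A) (J : idealr B).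
Variables (f : {rmorphism A -> B}) (fIJ : {in I, forall x, f x \in J}).

Lemma coherent_map (x : coherent_seq I) : (f \o x) \in coherent J.
Proof.
apply/coherentP => n /=; rewrite -rmorphB.
apply: (ideal_pow_morph (n := n) fIJ).
by have /coherentP /(_ n) := coherent_valP x.
Qed.

Definition completion_map (x : completion I) : completion J :=
  \pi_({ideal_quot (@null_seq B J)}) (CoherentSeq (coherent_map (repr x))).

Lemma completion_map_pi (x : coherent_seq I) :
  completion_map (\pi_({ideal_quot (@null_seq A I)}) x)
  = \pi_({ideal_quot (@null_seq B J)}) (CoherentSeq (coherent_map x)).
Proof.
apply/eqP; rewrite piE equivE; apply/null_seqP => n.
set y := repr _; rewrite -[coherent_val _ n]/(f (y n) - f (x n)) -rmorphB.
apply: (ideal_pow_morph fIJ); have : y = x %[mod {ideal_quot (@null_seq A I)}].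
  exact: reprK.
by move/eqP; rewrite piE equivE => /null_seqP /(_ n).
Qed.

Lemma completion_map_zmod_morphism : zmod_morphism completion_map.
Proof.
move=> x y; rewrite -[x]reprK -[y]reprK -rmorphB !completion_map_pi -rmorphB.
by congr (\pi_(_) _); apply/val_inj/funext => n; exact: rmorphB.
Qed.

Lemma completion_map_monoid_morphism : monoid_morphism completion_map.
Proof.
split=> [|x y].
  rewrite -[X in completion_map X](rmorph1 (\pi_({ideal_quot (@null_seq A I)}))).
  rewrite completion_map_pi -[RHS](rmorph1 (\pi_({ideal_quot (@null_seq B J)}))).
  by congr (\pi_(_) _); apply/val_inj/funext => n; exact: rmorph1.
rewrite -[x]reprK -[y]reprK -rmorphM !completion_map_pi -rmorphM.
by congr (\pi_(_) _); apply/val_inj/funext => n; exact: rmorphM.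
Qed.

HB.instance Definition _ := GRing.isZmodMorphism.Build (completion I)
  (completion J) completion_map completion_map_zmod_morphism.
HB.instance Definition _ := GRing.isMonoidMorphism.Build (completion I)
  (completion J) completion_map completion_map_monoid_morphism.

End CompletionMap.

Section Tensor.
Variables (R A B : comNzRingType).
Variables (f : {rmorphism R -> A}) (g : {rmorphism R -> B}).
Implicit Types s t : seq (A * B).

(* [A (x)_R B], where [f] and [g] are the structure maps: a list [s] stands for
   the sum of the [ab.1 (x) ab.2] for [ab] in [s]. *)
Inductive tensor_eq : seq (A * B) -> seq (A * B) -> Prop :=
| tensor_eq_perm s t : perm_eq s t -> tensor_eq s t
| tensor_eq_sym s t : tensor_eq s t -> tensor_eq t s
| tensor_eq_trans s t u : tensor_eq s t -> tensor_eq t u -> tensor_eq s u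
| tensor_eq_cat s s' t t' :
    tensor_eq s s' -> tensor_eq t t' -> tensor_eq (s ++ t) (s' ++ t')
| tensor_eq_0 b : tensor_eq [:: (0, b)] [::]
| tensor_eq_addl a a' b : tensor_eq [:: (a + a', b)] [:: (a, b); (a', b)]
| tensor_eq_addr a b b' : tensor_eq [:: (a, b + b')] [:: (a, b); (a, b')]
| tensor_eq_scale r a b : tensor_eq [:: (f r * a, b)] [:: (a, g r * b)].

Lemma tensor_eq_refl s : tensor_eq s s.
Proof. exact: tensor_eq_perm. Qed.

Definition tensor_rel s t : bool := `[< tensor_eq s t >].

Lemma tensor_rel_equiv : equiv_class_of tensor_rel.
Proof.
split=> [s|s t|t s u].
- exact/asboolP/tensor_eq_refl.
- by apply/asboolP/asboolP => /tensor_eq_sym.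
- move=> /asboolP h1 /asboolP h2; apply/asboolP; exact: tensor_eq_trans h1 h2.
Qed.

Canonical tensor_rel_canonical := EquivRelPack tensor_rel_equiv.
Canonical tensor_rel_encModRel := defaultEncModRel tensor_rel.

Definition tensor : Type := {eq_quot tensor_rel}.

HB.instance Definition _ : EqQuotient _ tensor_rel tensor :=
  EqQuotient.on tensor.
HB.instance Definition _ := Choice.on tensor.

Definition tensor_class s : tensor := \pi_tensor s.

Lemma tensor_classP s t : tensor_class s = tensor_class t <-> tensor_eq s t.
Proof.
split=> [/eqP|h]; first by rewrite /tensor_class piE => /asboolP.
by apply/eqP; rewrite /tensor_class piE; apply/asboolP.
Qed.

Lemma tensor_classK (x : tensor) : tensor_class (repr x) = x.
Proof. exact: reprK. Qed.

Lemma tensor_repr s : tensor_eq (repr (tensor_class s)) s.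
Proof. exact/tensor_classP/tensor_classK. Qed.

Definition pure (a : A) (b : B) : tensor := tensor_class [:: (a, b)].

Definition tensor_add (x y : tensor) := tensor_class (repr x ++ repr y).

Lemma tensor_addE s t :
  tensor_add (tensor_class s) (tensor_class t) = tensor_class (s ++ t).
Proof. by apply/tensor_classP/tensor_eq_cat; exact: tensor_repr. Qed.

Definition scale_seq (c : A * B) s := [seq (c.1 * ab.1, c.2 * ab.2) | ab <- s].

Lemma scale_seq_eq c s t :
  tensor_eq s t -> tensor_eq (scale_seq c s) (scale_seq c t).
Proof.
elim=> {s t} [s t h|s t _ h|s t u _ h1 _ h2|s s' t t' _ h1 _ h2|b|a a' b|a b b'
  |r a b] /=.
- exact/tensor_eq_perm/perm_map.
- exact: tensor_eq_sym.
- exact: tensor_eq_trans h1 h2.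
- by rewrite /scale_seq !map_cat; exact: tensor_eq_cat.
- by rewrite mulr0; exact: tensor_eq_0.
- by rewrite mulrDr; exact: tensor_eq_addl.
- by rewrite mulrDr; exact: tensor_eq_addr.
- rewrite [c.1 * _]mulrCA [c.2 * (_ * _)]mulrCA; exact: tensor_eq_scale.
Qed.

Definition tensor_opp (x : tensor) :=
  tensor_class (scale_seq (-1, 1) (repr x)).

Lemma tensor_oppE s :
  tensor_opp (tensor_class s) = tensor_class (scale_seq (-1, 1) s).
Proof. by apply/tensor_classP/scale_seq_eq; exact: tensor_repr. Qed.

Lemma tensor_addA : associative tensor_add.
Proof.
move=> x y z; rewrite -[x]tensor_classK -[y]tensor_classK -[z]tensor_classK.
by rewrite !tensor_addE catA.
Qed.

Lemma tensor_addC : commutative tensor_add.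
Proof.
move=> x y; apply/tensor_classP/tensor_eq_perm; exact/permPl/perm_catC.
Qed.

Lemma tensor_add0 : left_id (tensor_class [::]) tensor_add.
Proof. by move=> x; rewrite -[x]tensor_classK tensor_addE. Qed.

Lemma tensor_addN : left_inverse (tensor_class [::]) tensor_opp tensor_add.
Proof.
move=> x; rewrite -[x]tensor_classK tensor_oppE tensor_addE.
apply/tensor_classP; elim: (repr x) => [|[a b] s IH] /=.
  exact: tensor_eq_refl.
apply: (@tensor_eq_trans _
  ([:: (-1 * a, 1 * b); (a, b)] ++ (scale_seq (-1, 1) s ++ s))).
  by apply: tensor_eq_perm; rewrite /= perm_cons -cat1s perm_catCA.
apply: (@tensor_eq_cat _ [::] _ [::]) => //.
apply: tensor_eq_trans (tensor_eq_0 b); apply: tensor_eq_sym.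
by rewrite mul1r mulN1r -{1}(addNr a); exact: tensor_eq_addl.
Qed.

HB.instance Definition _ := GRing.isZmodule.Build tensor
  tensor_addA tensor_addC tensor_add0 tensor_addN.

Lemma tensor_class_cat s t :
  tensor_class (s ++ t) = tensor_class s + tensor_class t.
Proof. by rewrite -tensor_addE. Qed.

Definition mul_seq s t := [seq (c.1 * ab.1, c.2 * ab.2) | c <- s, ab <- t].

Lemma mul_seq_eqr u s t : tensor_eq s t -> tensor_eq (mul_seq u s) (mul_seq u t).
Proof.
move=> h; elim: u => [|c u IH]; first exact: tensor_eq_refl.
by rewrite /mul_seq !allpairs_cons; apply: tensor_eq_cat IH; exact: scale_seq_eq.
Qed.

Lemma mul_seq1 c s : mul_seq [:: c] s = scale_seq c s.
Proof. by rewrite /mul_seq allpairs1l. Qed.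

Lemma mul_seq_cons c s t : mul_seq (c :: s) t = scale_seq c t ++ mul_seq s t.
Proof. by rewrite /mul_seq allpairs_cons. Qed.

Lemma mul_seq_cat s t u : mul_seq (s ++ t) u = mul_seq s u ++ mul_seq t u.
Proof. by rewrite /mul_seq allpairs_cat. Qed.

Lemma mul_seqC s t : perm_eq (mul_seq s t) (mul_seq t s).
Proof.
elim: s => [|c s IH]; first by rewrite /mul_seq allpairs0r.
rewrite mul_seq_cons perm_sym.
rewrite /mul_seq (perm_allpairs_consr _ _ (fun=> c) (fun=> s)).
apply: perm_cat; last by rewrite perm_sym.
rewrite /scale_seq (eq_map (g := fun ab => (c.1 * ab.1, c.2 * ab.2))) // => ab.
by rewrite mulrC [ab.2 * _]mulrC.
Qed.

Definition tensor_mul (x y : tensor) := tensor_class (mul_seq (repr x) (repr y)).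

Lemma tensor_mulE s t :
  tensor_mul (tensor_class s) (tensor_class t) = tensor_class (mul_seq s t).
Proof.
apply/tensor_classP; apply: (@tensor_eq_trans _ (mul_seq (repr (tensor_class s)) t)).
  by apply: mul_seq_eqr; exact: tensor_repr.
apply: tensor_eq_trans (tensor_eq_perm (mul_seqC _ _)).
apply: tensor_eq_trans (tensor_eq_perm (mul_seqC _ _)) _.
by apply: mul_seq_eqr; exact: tensor_repr.
Qed.

Lemma tensor_mulC : commutative tensor_mul.
Proof. by move=> x y; apply/tensor_classP/tensor_eq_perm/mul_seqC. Qed.

Lemma scale_mul_seq c s t : mul_seq (scale_seq c s) t = scale_seq c (mul_seq s t).
Proof.
elim: s => [//|d s IH]; rewrite /= !mul_seq_cons IH /scale_seq map_cat -map_comp.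
by congr (_ ++ _); apply: eq_map => ab /=; rewrite !mulrA.
Qed.

Lemma tensor_mulA : associative tensor_mul.
Proof.
move=> x y z; rewrite -[x]tensor_classK -[y]tensor_classK -[z]tensor_classK.
rewrite !tensor_mulE; congr tensor_class.
elim: (repr x) => [//|c s IH].
by rewrite !mul_seq_cons mul_seq_cat scale_mul_seq IH.
Qed.

Lemma tensor_mul1 : left_id (tensor_class [:: (1, 1)]) tensor_mul.
Proof.
move=> x; rewrite -[x]tensor_classK tensor_mulE mul_seq1 /scale_seq.
by congr tensor_class; apply: map_id_in => -[a b] _ /=; rewrite !mul1r.
Qed.

Lemma tensor_mulDl : left_distributive tensor_mul +%R.
Proof.
move=> x y z; rewrite -[x]tensor_classK -[y]tensor_classK -[z]tensor_classK.
by rewrite -tensor_class_cat !tensor_mulE mul_seq_cat tensor_class_cat.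
Qed.

HB.instance Definition _ := GRing.Zmodule_isComPzRing.Build tensor
  tensor_mulA tensor_mulC tensor_mul1 tensor_mulDl.

Lemma pureM a b a' b' : pure a b * pure a' b' = pure (a * a') (b * b').
Proof. by rewrite [LHS]tensor_mulE mul_seq1. Qed.

Definition tensor_scale (b : B) (x : tensor) : tensor := pure 1 b * x.

Lemma tensor_scaleA b b' x :
  tensor_scale b (tensor_scale b' x) = tensor_scale (b * b') x.
Proof. by rewrite /tensor_scale mulrA pureM mulr1. Qed.

Lemma tensor_scale1 : left_id 1 tensor_scale.
Proof. by move=> x; rewrite /tensor_scale -[pure 1 1]/(1 : tensor) mul1r. Qed.

Lemma tensor_scaleDr : right_distributive tensor_scale +%R.
Proof. by move=> b x y; rewrite /tensor_scale mulrDr. Qed.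

Lemma tensor_scaleDl x : {morph tensor_scale^~ x : b b' / b + b'}.
Proof.
move=> b b'; rewrite /tensor_scale -mulrDl -tensor_class_cat; congr (_ * _).
exact/tensor_classP/tensor_eq_addr.
Qed.

HB.instance Definition _ := GRing.Zmodule_isLmodule.Build B tensor
  tensor_scaleA tensor_scale1 tensor_scaleDr tensor_scaleDl.

Lemma tensor_scale_pure b a b' : b *: pure a b' = pure a (b * b').
Proof. by rewrite [LHS]pureM mul1r. Qed.

(* The map [A (x)_R B -> C] induced by ring morphisms that agree on [R]. *)
Definition tensor_lift (C : pzRingType) (u : A -> C) (v : B -> C) (x : tensor) : C :=
  \sum_(ab <- repr x) u ab.1 * v ab.2.

Lemma tensor_lift_class (C : comPzRingType) (u : {rmorphism A -> C})
    (v : {rmorphism B -> C}) s :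
  (forall r, u (f r) = v (g r)) ->
  tensor_lift u v (tensor_class s) = \sum_(ab <- s) u ab.1 * v ab.2.
Proof.
move=> uv; rewrite /tensor_lift; move: (repr _) (tensor_repr s) => t; elim=> {t s}.
- by move=> s t st; exact: perm_big.
- by move=> s t _ ->.
- by move=> s t w _ -> _ ->.
- by move=> s s' t t' _ h1 _ h2; rewrite !big_cat /= h1 h2.
- by move=> b; rewrite big_cons !big_nil /= rmorph0 mul0r addr0.
- by move=> a a' b; rewrite !big_cons !big_nil !addr0 /= rmorphD mulrDl.
- by move=> a b b'; rewrite !big_cons !big_nil !addr0 /= rmorphD mulrDr.
- by move=> r a b; rewrite !big_cons !big_nil !addr0 /= !rmorphM uv mulrCA mulrA.
Qed.

End Tensor.

Section TensorMap.
Variables (R A A' B : comNzRingType).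
Variables (f : {rmorphism R -> A}) (f' : {rmorphism R -> A'}).
Variables (g : {rmorphism R -> B}).

(* [h (x) id], for an [R]-linear map [h] from [A] to [A']. *)
Definition tensor_map (h : A -> A') (x : tensor f g) : tensor f' g :=
  \sum_(ab <- repr x) pure f' g (h ab.1) ab.2.

Lemma tensor_map_class (h : {additive A -> A'}) s :
  (forall r a, h (f r * a) = f' r * h a) ->
  tensor_map h (tensor_class f g s) = \sum_(ab <- s) pure f' g (h ab.1) ab.2.
Proof.
move=> hf; rewrite /tensor_map; move: (repr _) (tensor_repr f g s) => t; elim=> {t s}.
- by move=> s t st; exact: perm_big.
- by move=> s t _ ->.
- by move=> s t w _ -> _ ->.
- by move=> s s' t t' _ h1 _ h2; rewrite !big_cat /= h1 h2.
- move=> b; rewrite big_cons !big_nil /= raddf0 addr0.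
  exact/tensor_classP/tensor_eq_0.
- move=> a a' b; rewrite !big_cons !big_nil !addr0 /= raddfD -tensor_class_cat.
  exact/tensor_classP/tensor_eq_addl.
- move=> a b b'; rewrite !big_cons !big_nil !addr0 /= -tensor_class_cat.
  exact/tensor_classP/tensor_eq_addr.
- move=> r a b; rewrite !big_cons !big_nil !addr0 /= hf.
  exact/tensor_classP/tensor_eq_scale.
Qed.

End TensorMap.

Section Padic.

Definition prime_number := {p : nat | prime p}.

Definition multiples (p : prime_number) : {pred int} :=
  fun x => (Posz (sval p) %| x)%Z.

Lemma multiplesE p x : (x \in multiples p) = (Posz (sval p) %| x)%Z.
Proof. by []. Qed.

Lemma multiples_ideal p : idealr_closed (multiples p).
Proof.
split=> [||a x y]; rewrite !multiplesE.
- exact: dvdz0.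
- by rewrite dvdzE /= dvdn1; case: p => p /= /prime_gt1; case: p => [|[|p]].
- by move=> hx hy; rewrite rpredD // dvdz_mull.
Qed.

HB.instance Definition _ p := isIdealr.Build int (multiples p) (multiples_ideal p).

Definition padic_int (p : prime_number) : Type := completion (multiples p).

HB.instance Definition _ p := GRing.ComNzRing.on (padic_int p).

Lemma multiples_pow p n x :
  (x \in ideal_pow (multiples p) n) = (Posz (sval p ^ n) %| x)%Z.
Proof.
elim: n x => [|n IH] x; first by rewrite expn0 dvd1z.
apply/ideal_mulP/idP => [[s [hs ->]]|/dvdzP [y ->]].
  rewrite big_seq; apply: rpred_sum => ab /hs /andP[]; rewrite IH => h1 h2.
  by rewrite expnS PoszM; exact: dvdz_mul.
exists [:: (Posz (sval p), y * Posz (sval p ^ n))]; split.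
  move=> _ /[!inE] /eqP -> /=; rewrite IH dvdz_mull // andbT.
  by rewrite multiplesE dvdzz.
by rewrite big_seq1 /= expnS PoszM mulrCA.
Qed.

Lemma dvdz_prime_pow (p : nat) m n (x y : int) : prime p ->
  (Posz (p ^ (m + n)) %| x * y)%Z -> (Posz (p ^ m) %| x)%Z || (Posz (p ^ n) %| y)%Z.
Proof.
move=> pp; rewrite !dvdzE !absz_nat abszM.
move: `|x|%N `|y|%N => {x y} a b.
have [-> _|a0] := posnP a; first by rewrite dvdn0.
have [-> _|b0] := posnP b; first by rewrite dvdn0 orbT.
rewrite !pfactor_dvdn ?muln_gt0 ?a0 // lognM //.
by case: (leqP m (logn p a)) => //= h1 h2; lia.
Qed.

Lemma coherent_multiples p (x : coherent_seq (multiples p)) m n : (m <= n)%N ->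
  (Posz (sval p ^ m) %| x n - x m)%Z.
Proof.
move=> /subnK <-; elim: (n - m)%N => [|k IH]; first by rewrite add0n subrr dvdz0.
have /coherentP /(_ (k + m)%N) := coherent_valP x.
rewrite multiples_pow addSn => h.
rewrite -[_ - _](subrKA (x (k + m)%N)) rpredD //.
by apply: dvdz_trans h; rewrite dvdzE !absz_nat dvdn_exp2l // leq_addl.
Qed.

Lemma null_seq_multiples_prime p :
  prime_idealr_closed (@null_seq _ (multiples p : idealr int)).
Proof.
move=> u v /null_seqP huv.
case: (boolP (u \in _)) => //= /null_seqP /existsNP [m].
rewrite multiples_pow => hm; apply/null_seqP => n; rewrite multiples_pow.
have := huv (m + n)%N; rewrite multiples_pow -[coherent_val _ _]/(u _ * v _).
move=> /(dvdz_prime_pow (svalP p)) /orP[h|h].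
  case: hm; rewrite -[X in (_ %| X)%Z](subKr (u (m + n)%N)) rpredB //.
  by apply: coherent_multiples; rewrite leq_addr.
rewrite -[X in (_ %| X)%Z](subKr (v (m + n)%N)) rpredB //.
by apply: coherent_multiples; rewrite leq_addl.
Qed.

Lemma padic_int_mulf_eq0 p (x y : padic_int p) :
  x * y = 0 -> (x == 0) || (y == 0).
Proof.
move=> /eqP; rewrite -[x]reprK -[y]reprK !piE !equivE !subr0.
move=> /null_seq_multiples_prime //.
Qed.

Definition padic_int_unit p : {pred padic_int p} :=
  fun x => `[< exists y, y * x = 1 >].

Definition padic_int_inv p (x : padic_int p) : padic_int p :=
  if pselect (exists y, y * x = 1) is left h then sval (cid h) else x.

Lemma padic_int_mulVx p : {in @padic_int_unit p, left_inverse 1 (@padic_int_inv p) *%R}.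
Proof.
move=> x /asboolP h; rewrite /padic_int_inv; case: pselect => // h'.
exact: svalP (cid h').
Qed.

Lemma padic_int_unitPl p (x y : padic_int p) : y * x = 1 -> padic_int_unit x.
Proof. by move=> h; apply/asboolP; exists y. Qed.

Lemma padic_int_invr_out p : {in [predC @padic_int_unit p], @padic_int_inv p =1 id}.
Proof.
by move=> x /asboolPn h; rewrite /padic_int_inv; case: pselect.
Qed.

HB.instance Definition _ p := GRing.ComNzRing_hasMulInverse.Build (padic_int p)
  (@padic_int_mulVx p) (@padic_int_unitPl p) (@padic_int_invr_out p).
HB.instance Definition _ p :=
  GRing.ComUnitRing_isIntegral.Build (padic_int p) (@padic_int_mulf_eq0 p).

Definition padic (p : prime_number) : Type := {fraction (padic_int p)}.

HB.instance Definition _ p := GRing.Field.on (padic p).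

Lemma padic_natr_eq0 p n : (n%:R == 0 :> padic p) = (n == 0)%N.
Proof.
apply/idP/eqP => [|-> //].
rewrite -(rmorph_nat (@tofrac (padic_int p))) tofrac_eq0.
have -> : n%:R = \pi_({ideal_quot (@null_seq _ (multiples p : idealr int))}) n%:R
  :> padic_int p by rewrite rmorph_nat.
rewrite piE equivE subr0 => /null_seqP h.
have {}h k : (sval p ^ k %| n)%N.
  have := h k; rewrite multiples_pow dvdzE absz_nat.
  suff -> : coherent_val (n%:R : coherent_seq (multiples p)) k = n :> int by [].
  elim: (n) => [//|m IH].
  by rewrite -addn1 natrD -[LHS]/(coherent_val m%:R k + 1) IH PoszD.
case: n h => // n /(_ n.+1) /dvdn_leq -/(_ isT).
by rewrite leqNgt ltn_expl // prime_gt1 //; case: p.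
Qed.

Lemma padic_intr_eq0 p (z : int) : (z%:~R == 0 :> padic p) = (z == 0).
Proof.
by case: z => n; rewrite ?NegzE ?rmorphN ?oppr_eq0 /= padic_natr_eq0.
Qed.

Lemma padic_ratr_zmod_morphism p : zmod_morphism (@ratr (padic p)).
Proof.
have injZtoQ: @injective rat int intr by apply: intr_inj.
have nz_den x: (denq x)%:~R != 0 :> padic p by rewrite padic_intr_eq0 denq_eq0.
move=> x y.
apply: (canLR (mulfK (nz_den _))); apply: (mulIf (nz_den x)).
rewrite mulrAC mulrBl divfK ?nz_den // mulrAC -!rmorphM.
apply: (mulIf (nz_den y)); rewrite mulrAC mulrBl divfK ?nz_den //.
rewrite -!(rmorphM, rmorphB); congr _%:~R; apply: injZtoQ.
rewrite !(rmorphM, rmorphB) /= [_ - _]lock /= -lock !numqE.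
by rewrite (mulrAC y) -!mulrBl -mulrA mulrAC !mulrA.
Qed.

Lemma padic_ratr_monoid_morphism p : monoid_morphism (@ratr (padic p)).
Proof.
have injZtoQ: @injective rat int intr by apply: intr_inj.
have nz_den x: (denq x)%:~R != 0 :> padic p by rewrite padic_intr_eq0 denq_eq0.
split=> [|x y]; first by rewrite /ratr divr1.
rewrite /ratr mulrC mulrAC; apply: canLR (mulKf (nz_den _)) _; rewrite !mulrA.
do 2!apply: canRL (mulfK (nz_den _)) _; rewrite -!rmorphM; congr _%:~R.
apply: injZtoQ; rewrite !rmorphM [x * y]lock /= !numqE -lock.
by rewrite -!mulrA mulrA mulrCA -!mulrA (mulrCA y).
Qed.

Definition rat_to_padic p : rat -> padic p := ratr.

HB.instance Definition _ p :=
  GRing.isZmodMorphism.Build rat (padic p) (@rat_to_padic p)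
    (padic_ratr_zmod_morphism p).
HB.instance Definition _ p :=
  GRing.isMonoidMorphism.Build rat (padic p) (@rat_to_padic p)
    (padic_ratr_monoid_morphism p).

End Padic.

Record etale := Etale {
  etale_deg : nat;
  etale_field : 'I_etale_deg.+1 -> fieldExtType rat }.

Arguments etale_field : clear implicits.

Definition etale_sort (K : etale) : Type := forall i, etale_field K i.
Coercion etale_sort : etale >-> Sortclass.

Section EtaleAlgebra.
Variable K : etale.
Implicit Types x y z : etale_sort K.

HB.instance Definition _ := gen_eqMixin (etale_sort K).
HB.instance Definition _ := gen_choiceMixin (etale_sort K).

Definition etale_zero : etale_sort K := fun i => 0.
Definition etale_one : etale_sort K := fun i => 1.
Definition etale_opp x : etale_sort K := fun i => - x i.
Definition etale_add x y : etale_sort K := fun i => x i + y i.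
Definition etale_mul x y : etale_sort K := fun i => x i * y i.
Definition etale_scale (q : rat) x : etale_sort K := fun i => q *: x i.

Lemma etale_addA : associative etale_add.
Proof. by move=> x y z; apply: functional_extensionality_dep => i; exact: addrA. Qed.
Lemma etale_addC : commutative etale_add.
Proof. by move=> x y; apply: functional_extensionality_dep => i; exact: addrC. Qed.
Lemma etale_add0 : left_id etale_zero etale_add.
Proof. by move=> x; apply: functional_extensionality_dep => i; exact: add0r. Qed.
Lemma etale_addN : left_inverse etale_zero etale_opp etale_add.
Proof. by move=> x; apply: functional_extensionality_dep => i; exact: addNr. Qed.

HB.instance Definition _ := GRing.isZmodule.Build (etale_sort K)
  etale_addA etale_addC etale_add0 etale_addN.

Lemma etale_mulA : associative etale_mul.
Proof. by move=> x y z; apply: functional_extensionality_dep => i; exact: mulrA. Qed.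
Lemma etale_mulC : commutative etale_mul.
Proof. by move=> x y; apply: functional_extensionality_dep => i; exact: mulrC. Qed.
Lemma etale_mul1 : left_id etale_one etale_mul.
Proof. by move=> x; apply: functional_extensionality_dep => i; exact: mul1r. Qed.
Lemma etale_mulDl : left_distributive etale_mul +%R.
Proof. by move=> x y z; apply: functional_extensionality_dep => i; exact: mulrDl. Qed.
Lemma etale_one_neq0 : etale_one != 0.
Proof.
apply/eqP => /(congr1 (fun x : etale_sort K => x ord0)) /eqP.
by rewrite -[etale_one _]/(1 : etale_field K ord0) oner_eq0.
Qed.

HB.instance Definition _ := GRing.Zmodule_isComNzRing.Build (etale_sort K)
  etale_mulA etale_mulC etale_mul1 etale_mulDl etale_one_neq0.

Lemma etale_scaleA a b x : etale_scale a (etale_scale b x) = etale_scale (a * b) x.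
Proof. by apply: functional_extensionality_dep => i; exact: scalerA. Qed.
Lemma etale_scale1 : left_id 1 etale_scale.
Proof. by move=> x; apply: functional_extensionality_dep => i; exact: scale1r. Qed.
Lemma etale_scaleDr : right_distributive etale_scale +%R.
Proof. by move=> a x y; apply: functional_extensionality_dep => i; exact: scalerDr. Qed.
Lemma etale_scaleDl x : {morph etale_scale^~ x : a b / a + b}.
Proof. by move=> a b; apply: functional_extensionality_dep => i; exact: scalerDl. Qed.

HB.instance Definition _ := GRing.Zmodule_isLmodule.Build rat (etale_sort K)
  etale_scaleA etale_scale1 etale_scaleDr etale_scaleDl.

Lemma etale_scaleAl (a : rat) x y : a *: (x * y) = (a *: x) * y.
Proof. by apply: functional_extensionality_dep => i; exact: scalerAl. Qed.

HB.instance Definition _ :=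
  GRing.Lmodule_isLalgebra.Build rat (etale_sort K) etale_scaleAl.
HB.instance Definition _ :=
  GRing.Lalgebra_isComAlgebra.Build rat (etale_sort K).

Import VectorInternalTheory.

Lemma etale_finDim :
  Vector.axiom (\sum_(i < (etale_deg K).+1) dim (etale_field K i))
    (etale_sort K).
Proof.
exists (fun x => \mxrow_i v2r (x i)).
  move=> a x y; apply/rowP => j; rewrite !mxE.
  by rewrite -[(a *: x + y) _]/(a *: x _ + y _) linearP !mxE.
pose unrow (r : 'rV_(\sum_(i < (etale_deg K).+1) dim (etale_field K i))) :
  etale_sort K := fun i => r2v (submxrow r i).
exists unrow => [x|r].
  by apply: functional_extensionality_dep => i; rewrite /unrow mxrowK v2rK.
by rewrite -[RHS]submxrowK; apply: eq_mxrow => i; rewrite /unrow r2vK.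
Qed.

HB.instance Definition _ :=
  Lmodule_hasFinDim.Build rat (etale_sort K) etale_finDim.

Definition integral_elts : {pred etale_sort K} := fun x =>
  `[< forall i, integralOver (intr : int -> etale_field K i) (x i) >].

Lemma integral_subring : subring_closed integral_elts.
Proof.
split=> [|x y /asboolP hx /asboolP hy|x y /asboolP hx /asboolP hy];
  apply/asboolP => i.
- exact: integral1.
- exact: (integral_sub (hx i) (hy i)).
- exact: (integral_mul (hx i) (hy i)).
Qed.

HB.instance Definition _ :=
  GRing.isSubringClosed.Build (etale_sort K) integral_elts integral_subring.

(* The ring of integers: the product of the rings of integers of the factors. *)
Record integers := Integers {
  integers_val :> etale_sort K;
  integers_valP : integers_val \in integral_elts }.

HB.instance Definition _ := [isSub for integers_val].
HB.instance Definition _ := [Choice of integers by <:].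
HB.instance Definition _ := [SubChoice_isSubComNzRing of integers by <:].

(* [idealr_closed] ideals are proper, hence so are the competitors [J] of a
   maximal ideal. *)
Record prime_of := PrimeOf {
  prime_pred : integers -> bool;
  prime_is_ideal : idealr_closed prime_pred;
  prime_maximal : forall J : integers -> bool, idealr_closed J ->
    {subset prime_pred <= J} -> {subset J <= prime_pred} }.

HB.instance Definition _ (P : prime_of) :=
  isIdealr.Build integers (prime_pred P) (prime_is_ideal P).

Definition prime_ideal (P : prime_of) : idealr integers := prime_pred P.
Coercion prime_ideal : prime_of >-> Idealr.type.

HB.instance Definition _ := gen_eqMixin prime_of.
HB.instance Definition _ := gen_choiceMixin prime_of.

End EtaleAlgebra.

Notation local_integers P := (completion (prime_ideal P)).

Definition lies_above (K : etale) (p : prime_number) (P : prime_of K) : Prop :=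
  (sval p)%:R \in (P : idealr (integers K)).

Section PIntegers.
Variables (K : etale) (p : prime_number).

(* [O_{K,p} = O_K (x)_Z Z_p] *)
Definition p_integers : Type :=
  tensor (intr : int -> integers K) (intr : int -> padic_int p).

Lemma lies_above_multiples (P : prime_of K) : lies_above p P ->
  {in multiples p, forall z, z%:~R \in (P : idealr (integers K))}.
Proof.
by move=> hP z /dvdzP [y ->]; rewrite rmorphM /= idealMr.
Qed.

(* The component at [P] of the identification of [O_{K,p}] with the product of
   the [O_{K,P}], for [P] above [p]. *)
Definition p_component (P : prime_of K) (hP : lies_above p P) :
    p_integers -> local_integers P :=
  tensor_lift (@completion_of _ (P : idealr _))
    (completion_map (f := intr) (lies_above_multiples hP)).

Lemma p_component_pure (P : prime_of K) (hP : lies_above p P) a z :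
  p_component hP (pure _ _ a z)
  = completion_of P a
    * completion_map (f := intr) (lies_above_multiples hP) z.
Proof.
by rewrite [LHS]tensor_lift_class ?big_seq1 // => r; rewrite !rmorph_int.
Qed.

End PIntegers.

Definition p_map (K L : etale) (p : prime_number)
    (A : {additive integers K -> integers L}) : p_integers K p -> p_integers L p :=
  tensor_map (intr : int -> integers L) A.

Arguments p_map {K L} p A _.

Lemma p_map_pure (K L : etale) (p : prime_number)
    (A : {additive integers K -> integers L}) a z :
  p_map p A (pure _ _ a z) = pure _ _ (A a) z.
Proof.
by rewrite [LHS]tensor_map_class ?big_seq1 // => r b; rewrite mulrzl raddfMz mulrzl.
Qed.

Record sieve (K : etale) := Sieve {
  sieve_set :> forall P : prime_of K, set (local_integers P);
  sieve_compact : forall P, compact (@sieve_set P);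
  sieve_open : forall P, open (@sieve_set P) }.

Arguments sieve_set {K} s P _.

Definition unsieved (K : etale) (R : sieve K) (p : prime_number) :
    set (p_integers K p) :=
  [set x | forall (P : prime_of K) (hP : lies_above p P),
             ~ R P (p_component hP x)].

Arguments unsieved {K} R p _.

(* [K (x)_Q Q_p] and [Q_p ^ n] are isomorphic as [Q_p]-algebras. *)
Definition splits_completely (K : etale) (p : prime_number) : Prop :=
  exists phi : {rmorphism
      tensor (@GRing.in_alg rat K) (@rat_to_padic p)
      -> {ffun 'I_(\dim {: K}) -> (padic p)^o}},
    bijective phi /\ (forall (c : padic p) x, phi (c *: x) = c *: phi x).

(* Main.v *)
(** Let Q be a prime of L above a prime number p as in the hypotheses.  Both
    O_K / P^N, for P above p, and O_L / Q^N are then isomorphic to Z / p^N.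

    Some power P^N of a prime P above p is mapped into Q by A.  Otherwise let
    A a lie in S_Q, take N so large that S_Q and all the R_P are stable under
    translation by the N-th powers, and let H be the group of the h with A h in
    Q^N; as O_L / Q^N is generated by the image of an element of P^N, the group
    H contains some h_P = 1 mod P^N for each P above p.  The points
    a + sum_P t_P h_P with 0 <= t_P < p^N are equidistributed modulo each P^N,
    and since the measures of the R_P sum to less than 1, one of them avoids all
    the R_P, but A maps it into S_Q.

    Modulo such a P^N every x in O_K is an integer k, so that A (x y) = k A y and
    A x = k A 1 modulo Q.  Hence A (x y) A 1 - A x A y lies in all the primes
    above infinitely many p, and it is 0: x |-> A x / A 1 is multiplicative.  No
    component of A 1 vanishes: otherwise this component of A vanishes, so that
    for some Q above p all the A x are 0 in O_{L,Q}; then 0 lies in S_Q by (b),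
    which contradicts (a) at an x that avoids all the R_P.

    The structure of the primes above a completely split p is read off from the
    n embeddings s_j of K in Q_p: an x in K with all s_j x in Z_p is integral up
    to an integer factor prime to p, because its characteristic polynomial is the
    product of the X - s_j x. *)
From HB Require Import structures.
Require Import Defs.
From mathcomp Require Import all_boot all_order all_algebra all_field.
From mathcomp Require Import generic_quotient ring_quotient fraction.
From mathcomp Require Import all_classical all_reals all_analysis.
From mathcomp Require Import finmap ring zify.

Set Implicit Arguments.
Unset Strict Implicit.
Unset Printing Implicit Defensive.

Import Order.TTheory GRing.Theory Num.Theory.
Import Quotient.

Local Open Scope classical_set_scope.
Local Open Scope quotient_scope.
Local Open Scope ring_scope.

(** * The p-adic numbers *)

Section PadicIntegers.
Variable p : prime_number.
Local Notation Zp := (padic_int p).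
Local Notation seqZ := (coherent_seq (multiples p)).
Local Notation ppow N := ((sval p ^ N)%:R).

Lemma pow_prime_gt0 N : (0 < sval p ^ N)%N.
Proof. by rewrite expn_gt0 (prime_gt0 (svalP p)). Qed.

Lemma natr_coherent (n : nat) k : coherent_val (n%:R : seqZ) k = n.
Proof.
elim: n => [//|n IH].
by rewrite -addn1 natrD -[LHS]/(coherent_val (n%:R : seqZ) k + 1) IH PoszD.
Qed.

Lemma intr_coherent (z : int) k : coherent_val (z%:~R : seqZ) k = z.
Proof.
case: z => n; first exact: natr_coherent.
by rewrite NegzE rmorphN -[LHS]/(- coherent_val (n.+1%:R : seqZ) k) natr_coherent.
Qed.

Definition padic_of_seq : {rmorphism seqZ -> Zp} :=
  \pi_({ideal_quot (@null_seq _ (multiples p : idealr int))}).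

Lemma padic_of_seq_surj (z : Zp) : exists u, z = padic_of_seq u.
Proof. by exists (repr z); exact: (esym (reprK z)). Qed.

Lemma padic_of_seq_eq (u v : seqZ) :
  padic_of_seq u = padic_of_seq v <->
  forall n, (Posz (sval p ^ n) %| u n - v n)%Z.
Proof.
split=> [/eqP|h].
  rewrite piE equivE => /null_seqP h n.
  by have := h n; rewrite multiples_pow.
apply/eqP; rewrite piE equivE; apply/null_seqP => n.
by rewrite multiples_pow; exact: h.
Qed.

(** For a sequence [x] representing [z], the differences [x (n + N) - x N] are all divisible by
    [p ^ N], and their quotients form a coherent sequence, which gives [w]; [k] is [x N]. *)
Lemma padic_int_approx N (z : Zp) : exists k w, z = k%:~R + ppow N * w :> Zp.
Proof.
have [x ->] := padic_of_seq_surj z.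
have cohN n : (Posz (sval p ^ N) %| x (n + N)%N - x N)%Z.
  by apply: coherent_multiples; rewrite leq_addl.
pose y n := ((x (n + N)%N - x N) %/ Posz (sval p ^ N))%Z.
have yE n : y n * Posz (sval p ^ N) = x (n + N)%N - x N by rewrite divzK.
have coh : y \in coherent (multiples p).
  apply/coherentP => n; rewrite multiples_pow.
  rewrite -(@dvdz_mul2r (Posz (sval p ^ N))); last first.
    by rewrite eqz_nat -lt0n pow_prime_gt0.
  rewrite mulrBl !yE -PoszM -expnD.
  rewrite (_ : _ - _ = x (n.+1 + N)%N - x (n + N)%N); last by ring.
  by apply: coherent_multiples; rewrite leq_add2r.
exists (x N), (padic_of_seq
  (CoherentSeq coh)).
rewrite -(rmorph_int padic_of_seq).
rewrite -(rmorph_nat padic_of_seq).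
rewrite -rmorphM -rmorphD; apply/padic_of_seq_eq => n.
rewrite -[X in _ - X]/(coherent_val ((x N)%:~R : seqZ) n
   + coherent_val ((sval p ^ N)%:R : seqZ) n * y n).
rewrite intr_coherent natr_coherent mulrC yE.
rewrite [X in x n - X]addrC subrK -opprB rpredN.
by apply: coherent_multiples; rewrite leq_addr.
Qed.

Lemma padic_int_dvdz N (k : int) (w : Zp) :
  k%:~R = ppow N * w -> (Posz (sval p ^ N) %| k)%Z.
Proof.
have [u ->] := padic_of_seq_surj w.
rewrite -(rmorph_int padic_of_seq).
rewrite -(rmorph_nat padic_of_seq).
rewrite -rmorphM => /padic_of_seq_eq /(_ N).
rewrite intr_coherent.
rewrite -[X in _ - X]/(coherent_val ((sval p ^ N)%:R : seqZ) N * u N).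
rewrite natr_coherent => h.
by rewrite -[k](subrK (Posz (sval p ^ N) * u N)) rpredD // dvdz_mulr.
Qed.

(** Inverses [v n] of [u n] modulo [p ^ n] are chosen independently by Bezout. They are
    automatically coherent: [u n * (v n.+1 - v n)] is divisible by [p ^ n], and [u n] is prime to
    [p ^ n]. *)
Lemma coherent_coprime_inv (u : seqZ) : ~~ (Posz (sval p) %| u 1%N)%Z ->
  exists v : seqZ, forall n, (Posz (sval p ^ n) %| v n * u n - 1)%Z.
Proof.
move=> hu.
have cop n : coprimez (Posz (sval p ^ n)) (u n).
  case: n => [|n]; first by rewrite coprimezE expn0 coprime1n.
  rewrite coprimezE /= coprime_pexpl //.
  rewrite prime_coprime; last exact: (svalP p).
  apply: contra hu => h.
  have h' : (Posz (sval p) %| u n.+1)%Z by rewrite dvdzE.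
  rewrite -[u 1%N](subKr (u n.+1)) rpredB //.
  have := coherent_multiples u (ltn0Sn n); rewrite expn1; exact.
have inv n : exists v, (Posz (sval p ^ n) %| v * u n - 1)%Z.
  have /coprimezP [[a b] /= ab] := cop n.
  exists b; rewrite (_ : _ - 1 = - (a * Posz (sval p ^ n))) ?rpredN ?dvdz_mull //.
  by rewrite -ab; ring.
have [v hv] := boolp.choice inv.
have coh : v \in coherent (multiples p).
  apply/coherentP => n; rewrite multiples_pow.
  rewrite -(Gauss_dvdzr _ (cop n)).
  have h1 := hv n; have h2 := hv n.+1.
  have {}h2 : (Posz (sval p ^ n) %| v n.+1 * u n.+1 - 1)%Z.
    by apply: dvdz_trans h2; rewrite dvdzE /= dvdn_exp2l.
  have h3 := coherent_multiples u (leqnSn n).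
  rewrite (_ : u n * _ = (v n.+1 * u n.+1 - 1) - (v n * u n - 1)
                     - v n.+1 * (u n.+1 - u n)); last by ring.
  by apply: rpredB; [apply: rpredB | exact: dvdz_mull].
by exists (CoherentSeq coh).
Qed.

(** [Z_p] is local: the residue [u 1] modulo [p] of a representing sequence decides between the two
    cases. *)
Lemma padic_int_unit_or_dvd (z : Zp) :
  (exists w, w * z = 1) \/ (exists w, z = (sval p)%:R * w).
Proof.
have [u zu] := padic_of_seq_surj z.
have [hu|hu] := boolP (Posz (sval p) %| u 1%N)%Z; [right|left].
  have [k [w zE]] := padic_int_approx 1 z.
  have : (Posz (sval p) %| k)%Z.
    have [w' ww'] := padic_of_seq_surj w.
    pose v : seqZ := k%:~R + (sval p ^ 1)%:R * w'.
    have uv : padic_of_seq u = padic_of_seq v.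
      by rewrite rmorphD rmorphM rmorph_int rmorph_nat -zu zE ww'.
    have /(_ 1%N) := (padic_of_seq_eq u v).1 uv.
    rewrite -[X in _ - X]/(coherent_val (k%:~R : seqZ) 1%N
      + coherent_val ((sval p ^ 1)%:R : seqZ) 1%N * coherent_val w' 1%N).
    rewrite intr_coherent natr_coherent expn1 => h.
    rewrite (_ : k = u 1%N - (u 1%N - (k + Posz (sval p) * coherent_val w' 1%N))
      - Posz (sval p) * coherent_val w' 1%N); last by ring.
    by apply: rpredB; [apply: rpredB; first exact: hu | exact/dvdz_mulr/dvdzz].
  case/dvdzP => l kE; exists (l%:~R + w).
  by rewrite zE kE rmorphM mulrDr expn1 mulrC.
have [v hv] := coherent_coprime_inv hu.
exists (padic_of_seq v).
rewrite zu -rmorphM.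
rewrite -[RHS](rmorph1 padic_of_seq).
by apply/padic_of_seq_eq => n; exact: hv.
Qed.

(** An element divisible by every power of [p] vanishes modulo every [p ^ n], so some [p ^ N] does
    not divide [z]. Induction on this [N] splits off factors [p] until a unit is left. *)
Lemma padic_int_factor (z : Zp) : z != 0 ->
  exists r u v, z = ppow r * u /\ v * u = 1.
Proof.
move=> z0.
suff [N hN] : exists N, ~ exists w, z = ppow N * w.
  elim: N z {z0} hN => [|N IH] z hN.
    by case: hN; exists z; rewrite expn0 mul1r.
  have [[w wz]|[w wz]] := padic_int_unit_or_dvd z.
    by exists 0%N, z, w; rewrite expn0 mul1r.
  have [|r [u [v [wE uv]]]] := IH w.
    by case=> y yE; apply: hN; exists y; rewrite wz yE mulrA -natrM expnS.
  by exists r.+1, u, v; split=> //; rewrite wz wE mulrA -natrM expnS.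
apply/existsNP => h; move/eqP: z0; apply.
have [u zu] := padic_of_seq_surj z; rewrite zu.
rewrite -[RHS](rmorph0 padic_of_seq).
apply/padic_of_seq_eq => n; rewrite subr0.
have [w] := h n; have [w' ->] := padic_of_seq_surj w; rewrite zu.
rewrite -(rmorph_nat padic_of_seq).
rewrite -rmorphM => /padic_of_seq_eq /(_ n).
rewrite -[X in _ - X]/(coherent_val ((sval p ^ n)%:R : seqZ) n * coherent_val w' n).
rewrite natr_coherent => h'.
by rewrite -[u n](subrK (Posz (sval p ^ n) * coherent_val w' n)) rpredD // dvdz_mulr.
Qed.

End PadicIntegers.

Lemma fraction_surj (R : idomainType) (x : {fraction R}) :
  exists u v, v != 0 /\ x * tofrac v = tofrac u.
Proof.
elim/quotW: x => y; exists (frac y).1, (frac y).2; split.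
  exact: denom_ratioP.
unlock tofrac; rewrite -[LHS]FracField.pi_mul; apply/eqP.
rewrite FracField.equivf_def /FracField.mulf.
by rewrite !numden_Ratio ?mulr1 ?oner_eq0 ?denom_ratioP // mulrC.
Qed.

(** * Divisibility by powers of p in the field of p-adic numbers *)

Section PadicField.
Variable p : prime_number.
Local Notation Zp := (padic_int p).
Local Notation Qp := (padic p).
Local Notation pp N := ((sval p ^ N)%:R).
Implicit Types (x y : Qp) (M N : nat).

(* [x] lies in [p ^ N Z_p]. *)
Definition pdvd N x : Prop := exists w : Zp, x = pp N * tofrac w.

Lemma pdvd0 N : pdvd N 0.
Proof. by exists 0; rewrite rmorph0 mulr0. Qed.

Lemma pdvdD N x y : pdvd N x -> pdvd N y -> pdvd N (x + y).
Proof. by move=> [u ->] [v ->]; exists (u + v); rewrite rmorphD mulrDr. Qed.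

Lemma pdvdN N x : pdvd N x -> pdvd N (- x).
Proof. by move=> [u ->]; exists (- u); rewrite rmorphN mulrN. Qed.

Lemma pdvdB N x y : pdvd N x -> pdvd N y -> pdvd N (x - y).
Proof. by move=> hx hy; apply: pdvdD => //; apply: pdvdN. Qed.

Lemma pdvdM M N x y : pdvd M x -> pdvd N y -> pdvd (M + N) (x * y).
Proof.
move=> [u ->] [v ->]; exists (u * v).
by rewrite rmorphM expnD natrM mulrACA.
Qed.

Lemma pdvdMl N x y : pdvd 0 x -> pdvd N y -> pdvd N (x * y).
Proof. exact: pdvdM. Qed.

Lemma pdvdMr N x y : pdvd N x -> pdvd 0 y -> pdvd N (x * y).
Proof. by rewrite mulrC => hx hy; apply: pdvdMl. Qed.

Lemma pdvd_natM M N x : pdvd (M + N) (pp M * x) <-> pdvd N x.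
Proof.
split=> [[u]|[u ->]]; last by exists u; rewrite mulrA -natrM expnD.
rewrite expnD natrM -mulrA => h; exists u; apply: mulfI h.
by rewrite padic_natr_eq0 -lt0n pow_prime_gt0.
Qed.

Lemma pdvd_pp M : pdvd M (pp M).
Proof. by exists 1; rewrite rmorph1 mulr1. Qed.

Lemma pdvd_le M N x : (M <= N)%N -> pdvd N x -> pdvd M x.
Proof.
move=> /subnKC <- [u ->]; rewrite expnD natrM -mulrA.
by exists (pp (N - M) * u); rewrite rmorphM rmorph_nat.
Qed.

Lemma pdvd_int (z : int) : pdvd 0 z%:~R.
Proof. by exists z%:~R; rewrite rmorph_int mul1r. Qed.

Lemma pdvd1 : pdvd 0 1.
Proof. by exists 1; rewrite rmorph1 mulr1. Qed.

Lemma pdvd_sum (I : Type) (r : seq I) (P : pred I) (F : I -> Qp) N :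
  (forall i, P i -> pdvd N (F i)) -> pdvd N (\sum_(i <- r | P i) F i).
Proof.
move=> h; elim/big_rec: _ => [|i x Pi]; first exact: pdvd0.
by apply: pdvdD; apply: h.
Qed.

Lemma pdvd_prod (I : Type) (r : seq I) (P : pred I) (F : I -> Qp) :
  (forall i, P i -> pdvd 0 (F i)) -> pdvd 0 (\prod_(i <- r | P i) F i).
Proof.
move=> h; elim/big_rec: _ => [|i x Pi]; first exact: pdvd1.
by apply: pdvdMl; apply: h.
Qed.

Lemma pdvd_exp N x k : pdvd N x -> pdvd (N * k) (x ^+ k).
Proof.
move=> h; elim: k => [|k IH]; first by rewrite muln0; apply: pdvd1.
by rewrite mulnS exprS; apply: pdvdM.
Qed.

Lemma pdvd_intr N (z : int) : pdvd N z%:~R <-> (Posz (sval p ^ N) %| z)%Z.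
Proof.
split=> [[u]|/dvdzP[k ->]].
  rewrite -(rmorph_int (@tofrac Zp)) -(rmorph_nat (@tofrac Zp)) -rmorphM.
  by move=> /eqP; rewrite tofrac_eq => /eqP; apply: padic_int_dvdz.
by exists k%:~R; rewrite rmorphM mulrC rmorph_int.
Qed.

Lemma pdvd_approx N x : pdvd 0 x -> exists k : int, pdvd N (x - k%:~R).
Proof.
move=> [z ->]; have [k [w ->]] := padic_int_approx N z.
exists k; exists w.
by rewrite mul1r rmorphD rmorph_int rmorphM rmorph_nat addrC addKr.
Qed.

(** The denominator of [x] is a unit times some [p ^ r], so multiplying by [p ^ r] clears it. *)
Lemma pdvd_exists x : exists r, pdvd 0 (pp r * x).
Proof.
have [u [v [v0 xv]]] := fraction_surj x.
have [r [w [w' [vE ww]]]] := padic_int_factor v0.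
exists r; exists (w' * u); rewrite mul1r tofracM -xv vE tofracM rmorph_nat.
have : tofrac w' * tofrac w = 1 :> Qp by rewrite -tofracM ww tofrac1.
by move=> ww1; rewrite mulrCA [tofrac w' * _]mulrCA ww1 mulr1 mulrC.
Qed.

(** The integral element [p ^ r * x] is approximated by an integer to precision [r + N]; dividing by
    [p ^ r] leaves precision [N]. *)
Lemma pdvd_approx_rat N x : exists q : rat, pdvd N (x - ratr q).
Proof.
have [r xr] := pdvd_exists x; have [k hk] := pdvd_approx (r + N) xr.
have pr0 : pp r != 0 :> Qp by rewrite padic_natr_eq0 -lt0n pow_prime_gt0.
exists (k%:~R / pp r); apply: (proj1 (pdvd_natM r N _)).
rewrite -/(rat_to_padic p _) fmorph_div rmorph_int rmorph_nat mulrBr.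
by rewrite [X in _ - X]mulrC divfK.
Qed.

(** [Z_p] is a valuation ring. By induction on [r] with [p ^ r * x] integral: this product is either
    a unit, and then [1 / x] is divisible by [p ^ r], or a multiple of [p], and then [r] can be
    lowered. *)
Lemma pdvd_or_inv x : pdvd 0 x \/ exists y, pdvd 1 y /\ x * y = 1.
Proof.
have [r] := pdvd_exists x; elim: r => [|r IH]; first by rewrite mul1r; left.
case=> z; rewrite mul1r => zE.
have [[w wz]|[w wz]] := padic_int_unit_or_dvd z.
  right; exists (pp r.+1 * tofrac w); split.
    by apply: (pdvd_le (ltn0Sn r)); exists w.
  by rewrite mulrA [x * _]mulrC zE -rmorphM mulrC wz rmorph1.
apply: IH; exists w; rewrite mul1r; apply: (@mulfI _ (pp 1)).
  by rewrite padic_natr_eq0 -lt0n pow_prime_gt0.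
by rewrite mulrA -natrM -expnD zE wz expn1 rmorphM rmorph_nat.
Qed.

(** An integer close to [x] is prime to [p], and Bezout inverts it modulo [p ^ N]. *)
Lemma pdvd_unit_inv N x : pdvd 0 x -> ~ pdvd 1 x ->
  exists k : int, pdvd N (k%:~R * x - 1).
Proof.
move=> x0 x1; have [k hk] := pdvd_approx N.+1 x0.
have pk : coprimez (Posz (sval p ^ N)) k.
  rewrite coprimezE /=; case: N hk => [|N] hk; first by rewrite coprime1n.
  rewrite coprime_pexpl // prime_coprime; last exact: (svalP p).
  apply/negP => h; apply: x1; rewrite -[x](subrK k%:~R); apply: pdvdD.
    exact: pdvd_le hk.
  by apply/pdvd_intr; rewrite expn1 dvdzE.
have /coprimezP [[a b] /= ab] := pk.
exists b; rewrite (_ : _ - 1 = b%:~R * (x - k%:~R) - (a * Posz (sval p ^ N))%:~R).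
  apply: pdvdB; first by apply: pdvdMl; [exact: pdvd_int|exact: pdvd_le hk].
  by apply/pdvd_intr; rewrite dvdz_mull.
have : (a * Posz (sval p ^ N) + b * k)%:~R = 1 :> Qp by rewrite ab.
rewrite intrD (intrM _ b k); move: (b%:~R) (k%:~R) (_%:~R) => b' k' a'.
have : forall (R : comPzRingType) (b k a x : R), a + b * k = 1 ->
    b * x - 1 = b * (x - k) - a.
  by move=> A b1 k1 a1 x1' <-; ring.
by move=> h; apply: h.
Qed.

Lemma pdvd_prime x y : pdvd 0 x -> pdvd 0 y -> pdvd 1 (x * y) ->
  pdvd 1 x \/ pdvd 1 y.
Proof.
move=> x0 y0 xy; have [|x1] := pselect (pdvd 1 x); first by left.
right; have [k hk] := pdvd_unit_inv 1 x0 x1.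
rewrite (_ : y = k%:~R * (x * y) - (k%:~R * x - 1) * y); last first.
  by rewrite mulrBl mul1r mulrA subKr.
by apply: pdvdB; [apply: pdvdMl => //; exact: pdvd_int | apply: pdvdMr].
Qed.

Lemma not_pdvd1 : ~ pdvd 1 1.
Proof.
move=> h; have /pdvd_intr : pdvd 1 (1%:~R) by [].
by rewrite dvdzE /= expn1 dvdn1 => /eqP p1; have := svalP p; rewrite p1.
Qed.

Lemma pdvd_ratr (q : rat) : pdvd 0 (ratr q : Qp) -> ~~ (sval p %| denq q)%Z.
Proof.
move=> h; apply/negP => pd.
have : pdvd 1 (numq q)%:~R.
  have -> : (numq q)%:~R = ratr q * (denq q)%:~R :> Qp.
    by rewrite /ratr divfK // padic_intr_eq0 denq_eq0.
  by apply: pdvdMl => //; apply/pdvd_intr; rewrite expn1.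
move/pdvd_intr; rewrite expn1 => pn.
have := coprime_num_den q; rewrite /coprime => /eqP g.
have : (sval p %| 1)%N.
  by rewrite -g dvdn_gcd; rewrite !dvdzE in pn pd; rewrite pn pd.
by rewrite dvdn1 => /eqP p1; have := svalP p; rewrite p1.
Qed.

(** [Z_p] is integrally closed. If [x] is not integral, its inverse [y] is divisible by [p];
    multiplying [f(x) = 0] by [y ^+ d], with [d] the degree, writes 1 as a sum of terms in
    [f_i y ^+ (d - i)] with [i < d], all divisible by [p]. *)
Lemma pdvd_root_monic (f : {poly Qp}) x :
  f \is monic -> (forall i, pdvd 0 f`_i) -> root f x -> pdvd 0 x.
Proof.
move=> /monicP fm f0 fx; have [//|[y [y1 xy]]] := pdvd_or_inv x.
have : (0 < size f)%N by rewrite lt0n size_poly_eq0 -lead_coef_eq0 fm oner_eq0.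
case sf : (size f) => [//|d] _.
have yk k : x ^+ k * y ^+ k = 1 by rewrite -exprMn xy expr1n.
move: fx => /eqP; rewrite horner_coef sf big_ord_recr /=.
move: fm; rewrite lead_coefE sf /= => ->; rewrite mul1r.
move=> /(congr1 ( *%R^~ (y ^+ d))); rewrite mulrDl yk mul0r mulr_suml.
move=> /(canRL (addKr _)); rewrite addr0 => one.
case: (@not_pdvd1); rewrite one; apply/pdvdN/pdvd_sum => i _.
have -> : y ^+ d = y ^+ i * y ^+ (d - i) by rewrite -exprD subnKC // ltnW.
rewrite mulrA -(mulrA f`_i) yk mulr1; apply: pdvdMl => //.
have := pdvd_exp (d - i) y1; rewrite mul1n; apply: pdvd_le.
by rewrite subn_gt0.
Qed.

End PadicField.

(** * Embeddings given by a complete splitting *)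

Lemma pureDl (R A B : comNzRingType) (f : {rmorphism R -> A})
    (g : {rmorphism R -> B}) a a' b :
  pure f g (a + a') b = pure f g a b + pure f g a' b.
Proof. by rewrite -tensor_class_cat; exact/tensor_classP/tensor_eq_addl. Qed.

Section Embeddings.
Variables (K : etale) (p : prime_number).
Local Notation n := (\dim {: K}).
Local Notation Qp := (padic p).
Local Notation KQp := (tensor (@GRing.in_alg rat K) (@rat_to_padic p)).

(* The second clause says that the [s i] come from a surjection of
   [K (x)_Q Q_p] onto [Q_p ^ n]. *)
Definition splitting_embeddings (s : 'I_n -> {rmorphism K -> Qp}) : Prop :=
  (forall i (q : rat) x, s i (q *: x) = ratr q * s i x) /\
  (forall i, exists t : seq (K * Qp),
     forall j, \sum_(ab <- t) s j ab.1 * ab.2 = (j == i)%:R).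

Section FromIsomorphism.
Variable phi : {rmorphism KQp -> {ffun 'I_n -> Qp^o}}.
Hypothesis phi_scale : forall (c : Qp) x, phi (c *: x) = c *: phi x.

Definition coord_embedding i (x : K) : Qp := phi (pure _ _ x 1) i.

Lemma coord_embedding_pure i x c : phi (pure _ _ x c) i = c * coord_embedding i x.
Proof.
by rewrite -[c in LHS]mulr1 -tensor_scale_pure phi_scale ffunE.
Qed.

Lemma coord_embeddingD i x y :
  coord_embedding i (x + y) = coord_embedding i x + coord_embedding i y.
Proof. by rewrite /coord_embedding pureDl rmorphD ffunE. Qed.

Lemma coord_embedding_zmod i : zmod_morphism (coord_embedding i).
Proof.
by move=> x y; rewrite -[x in RHS](subrK y) [in RHS]coord_embeddingD addrK.
Qed.

Lemma coord_embedding_monoid i : monoid_morphism (coord_embedding i).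
Proof.
split=> [|x y]; first by rewrite /coord_embedding rmorph1 ffunE.
by rewrite /coord_embedding -[X in pure _ _ _ X]mulr1 -pureM rmorphM ffunE.
Qed.

HB.instance Definition _ i := GRing.isZmodMorphism.Build K Qp
  (coord_embedding i) (coord_embedding_zmod i).
HB.instance Definition _ i := GRing.isMonoidMorphism.Build K Qp
  (coord_embedding i) (coord_embedding_monoid i).

End FromIsomorphism.

Lemma splits_completely_embeddings : splits_completely K p ->
  exists s, splitting_embeddings s.
Proof.
case=> phi [[psi _ psiK] phi_scale].
exists (fun i => coord_embedding phi i); split=> [i q x|i] /=.
  rewrite -[RHS](coord_embedding_pure phi_scale) /coord_embedding.
  congr (phi _ i); apply/tensor_classP.
  rewrite -[q *: x]mulr_algl -[ratr q]mulr1; exact: tensor_eq_scale.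
pose d : {ffun 'I_n -> Qp^o} := [ffun j => (j == i)%:R].
exists (repr (psi d)) => j.
have -> : (j == i)%:R = phi (psi d) j :> Qp by rewrite psiK ffunE.
rewrite -[X in phi X]tensor_classK.
elim: (repr (psi d)) => [|[a b] t IH].
  rewrite big_nil -[tensor_class _ _ _]/(0 : KQp) rmorph0 ffunE //.
rewrite big_cons -cat1s tensor_class_cat rmorphD ffunE IH; congr (_ + _).
by rewrite mulrC [RHS](coord_embedding_pure phi_scale).
Qed.

End Embeddings.

(** * Integrality read off from characteristic polynomials *)

Lemma char_poly_conj (R : idomainType) n (B A D : 'M[R]_n) :
  B \in unitmx -> D *m B = B *m A -> char_poly A = char_poly D.
Proof.
move=> Bu DB; have := det_mulmx (map_mx polyC B) (char_poly_mx A).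
have -> : map_mx polyC B *m char_poly_mx A = char_poly_mx D *m map_mx polyC B.
  rewrite /char_poly_mx mulmxBr mulmxBl -!map_mxM -DB; congr (_ - _).
  by rewrite scalar_mxC.
rewrite det_mulmx mulrC => h.
have Bu' : \det (map_mx polyC B) \is a GRing.unit.
  by rewrite det_map_mx rmorph_unit // -unitmxE.
exact: (esym (mulrI Bu' h)).
Qed.

Section EtaleProj.
Variables (K : etale) (i : 'I_(etale_deg K).+1).

Definition etale_proj (x : K) : etale_field K i := x i.

Lemma etale_proj_zmod : zmod_morphism etale_proj. Proof. by []. Qed.
Lemma etale_proj_monoid : monoid_morphism etale_proj. Proof. by []. Qed.
Lemma etale_proj_scalable : scalable etale_proj. Proof. by []. Qed.

HB.instance Definition _ := GRing.isZmodMorphism.Build K (etale_field K i)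
  etale_proj etale_proj_zmod.
HB.instance Definition _ := GRing.isMonoidMorphism.Build K (etale_field K i)
  etale_proj etale_proj_monoid.
HB.instance Definition _ := GRing.isScalable.Build rat K (etale_field K i) *:%R
  etale_proj etale_proj_scalable.
End EtaleProj.

(** If [d] is the degree of [g], then [m x] is a root of the monic polynomial with coefficients
    [g_k m ^ (d - k)]. These are integers: each one with [k < d] contains the factor [m g_k]. *)
Lemma integral_multiple (K : etale) (x : K) (g : {poly rat}) (m : int) :
  g \is monic -> \sum_(k < size g) g`_k *: x ^+ k = 0 ->
  (forall k, m%:~R * g`_k \is a Num.int) ->
  exists y : integers K, integers_val y = m%:~R * x.
Proof.
move=> gm gx mg.
suff h : m%:~R * x \in @integral_elts K by exists (Integers h).
apply/asboolP => i.
have sg : (0 < size g)%N by rewrite lt0n size_poly_eq0 monic_neq0.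
set d := (size g).-1.
have sgE : size g = d.+1 by rewrite prednK.
have gd : g`_d = 1 by have /monicP := gm.
pose c (k : nat) : rat := g`_k * m%:~R ^+ (d - k).
have cint k : (k <= d)%N -> (numq (c k))%:~R = c k.
  move=> kd; apply: numqK; rewrite /c.
  have [->|nk] := eqVneq k d; first by rewrite gd mul1r subnn expr0.
  have : (0 < d - k)%N by rewrite subn_gt0 ltn_neqAle nk.
  case: (d - k)%N => // e _; rewrite exprS mulrA [g`_k * _]mulrC.
  by apply: rpredM => //; rewrite rpredX // intr_int.
pose q : {poly int} := \poly_(k < d.+1) numq (c k).
have qd : numq (c d) = 1 by rewrite /c gd mul1r subnn expr0.
have sq : size q = d.+1 by rewrite size_poly_eq // qd oner_eq0.
exists q.
  by rewrite monicE lead_coefE sq coef_poly ltnSn qd.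
have intrE (z : int) : z%:~R = (z%:~R : rat) *: 1 :> etale_field K i.
  by rewrite scaler_int.
apply/rootP; rewrite (@horner_coef_wide _ d.+1); last first.
  by rewrite -sq; exact: size_poly.
have := congr1 (@etale_proj K i) gx; rewrite raddf0 raddf_sum /= sgE => gxi.
transitivity (m%:~R ^+ d * \sum_(k < d.+1) etale_proj i (g`_k *: x ^+ k));
  last by rewrite gxi mulr0.
rewrite mulr_sumr; apply: eq_bigr => k _.
rewrite linearZ /= rmorphXn /= coef_map coef_poly ltn_ord /=.
rewrite -[(_ * x) i]/(etale_proj i (m%:~R * x)).
have kd : (k <= d)%N by rewrite -ltnS.
rewrite (intrE (numq _)) cint // rmorphM rmorph_int exprMn.
have -> : (c k)%:A = (g`_k)%:A * m%:~R ^+ (d - k) :> etale_field K i.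
  by rewrite /c -!in_algE rmorphM rmorphXn /= scaler_int.
have -> : m%:~R ^+ d = m%:~R ^+ (d - k) * m%:~R ^+ k :> etale_field K i.
  by rewrite -exprD subnK.
rewrite -[g`_k *: etale_proj i x ^+ k]mulr_algl.
by rewrite [RHS]mulrACA (mulrC _ (g`_k)%:A).
Qed.

Lemma horner_prod_XsubC (R : comNzRingType) (I : finType) (f : I -> R) j :
  (\prod_i ('X - (f i)%:P)).[f j] = 0.
Proof. by rewrite horner_prod (bigD1 j) //= hornerXsubC subrr mul0r. Qed.

Lemma denq_prod_int (g : {poly rat}) k :
  (\prod_(k < size g) denq g`_k)%:~R * g`_k \is a Num.int.
Proof.
have [kg|kg] := ltnP k (size g); last first.
  by rewrite nth_default // mulr0 rpred0.
rewrite (bigD1 (Ordinal kg)) //= rmorphM /= mulrAC.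
rewrite mulrC [X in _ * X]mulrC -numqE.
by rewrite rpredM // intr_int.
Qed.

Section SplittingEmbeddings.
Variables (K : etale) (p : prime_number).
Local Notation n := (\dim {: K}).
Local Notation Qp := (padic p).
Variable s : 'I_n -> {rmorphism K -> Qp}.
Hypothesis sP : splitting_embeddings s.

Local Notation e := (vbasis {: K}).

Definition embedding_matrix : 'M[Qp]_n := \matrix_(j, k) s j e`_k.

Lemma embeddingZ i (q : rat) x : s i (q *: x) = ratr q * s i x.
Proof. by case: sP => h _; exact: h. Qed.

Lemma embedding_coord j x :
  s j x = \sum_k embedding_matrix j k * ratr (coord e k x).
Proof.
rewrite [in LHS](coord_vbasis (memvf x)) rmorph_sum; apply: eq_bigr => k _.
by rewrite /= embeddingZ mxE mulrC.
Qed.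

(** The preimages [t i] of the standard basis vectors of [Q_p ^ n], written in the basis of [K], are
    the columns of a right inverse. *)
Lemma embedding_matrix_unit : embedding_matrix \in unitmx.
Proof.
case: sP => _ /boolp.choice [t tE].
suff h : embedding_matrix *m
    (\matrix_(k, i) \sum_(ab <- t i) ratr (coord e k ab.1) * ab.2) = 1%:M.
  exact: (proj1 (mulmx1_unit h)).
apply/matrixP => j i; rewrite !mxE -tE.
under eq_bigr => k _ do rewrite [X in _ * X]mxE mulr_sumr.
rewrite exchange_big; apply: eq_bigr => ab _ /=.
rewrite (embedding_coord j) mulr_suml; apply: eq_bigr => k _.
by rewrite mulrA.
Qed.

Lemma embeddings_inj x : (forall j, s j x = 0) -> x = 0.
Proof.
move=> sx0; rewrite (coord_vbasis (memvf x)) big1 // => k _.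
suff /matrixP /(_ k 0) : \col_k ratr (coord e k x) = 0 :> 'cV[Qp]_n.
  by rewrite !mxE => /eqP; rewrite -/(rat_to_padic p _) fmorph_eq0 => /eqP ->; rewrite scale0r.
rewrite -[LHS](mulKmx embedding_matrix_unit).
rewrite (_ : embedding_matrix *m _ = 0) ?mulmx0 //.
apply/colP => j; rewrite !mxE -[RHS](sx0 j) embedding_coord.
by apply: eq_bigr => k' _; rewrite [X in _ * X]mxE.
Qed.

(** The embedding matrix conjugates multiplication by [x] on [K] to the diagonal matrix of the
    [s j x]. That [g] kills [x] can be checked after each [s j], as the embeddings are jointly
    injective. *)
Lemma embeddings_char_poly x : exists g : {poly rat},
  [/\ g \is monic, \sum_(k < size g) g`_k *: x ^+ k = 0 &
      map_poly (@rat_to_padic p) g = \prod_j ('X - (s j x)%:P)].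
Proof.
(* The matrix of multiplication by [x] in the basis [e]. *)
pose M : 'M[rat]_n := \matrix_(l, k) coord e l (x * e`_k).
pose D : 'M[Qp]_n := diag_mx (\row_j s j x).
have DB : D *m embedding_matrix = embedding_matrix *m map_mx (@rat_to_padic p) M.
  apply/matrixP => j k; rewrite mul_diag_mx !mxE -rmorphM embedding_coord.
  by apply: eq_bigr => l _; rewrite !mxE.
have gE : map_poly (@rat_to_padic p) (char_poly M) = \prod_j ('X - (s j x)%:P).
  rewrite map_char_poly (char_poly_conj embedding_matrix_unit DB).
  rewrite char_poly_trig; last exact: diag_mx_is_trig.
  apply: eq_bigr => j _.
  by rewrite !mxE eqxx.
exists (char_poly M); split=> //; first exact: char_poly_monic.
apply: embeddings_inj => j.
rewrite rmorph_sum /=.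
transitivity ((map_poly (@rat_to_padic p) (char_poly M)).[s j x]).
  rewrite horner_coef size_map_poly; apply: eq_bigr => k _.
  by rewrite embeddingZ coef_map rmorphXn.
by rewrite gE (horner_prod_XsubC (fun j => s j x)).
Qed.

Lemma prod_XsubC_pdvd (I : Type) (r : seq I) (f : I -> Qp) :
  (forall j, pdvd 0 (f j)) -> forall k, pdvd 0 (\prod_(j <- r) ('X - (f j)%:P))`_k.
Proof.
move=> f0; elim: r => [|i r IH] k.
  by rewrite big_nil coef1; case: (k == 0)%N; [exact: pdvd1 | exact: pdvd0].
rewrite big_cons mulrBl coefB coefXM coefCM; apply: pdvdB.
  by case: ifP => _; [exact: pdvd0 | exact: IH].
by apply: pdvdMl.
Qed.

(** The coefficients of the characteristic polynomial are rational and lie in [Z_p], so their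
    denominators are prime to [p]; [m] is the product of these denominators. *)
Lemma embeddings_integral x : (forall j, pdvd 0 (s j x)) ->
  exists m (y : integers K),
    ~~ (Posz (sval p) %| m)%Z /\ integers_val y = m%:~R * x.
Proof.
move=> x0; have [g [gm gx gE]] := embeddings_char_poly x.
pose m : int := \prod_(k < size g) denq g`_k.
have pm : ~~ (Posz (sval p) %| m)%Z.
  rewrite /m; elim/big_rec: _ => [|k y _ IH].
    by rewrite dvdzE /= dvdn1; apply/eqP => p1; have := svalP p; rewrite p1.
  rewrite dvdzE abszM Euclid_dvdM; last exact: (svalP p).
  rewrite negb_or IH andbT; apply: pdvd_ratr.
  have := prod_XsubC_pdvd (index_enum _) x0 k.
  by rewrite -gE coef_map.
have [|y yE] := integral_multiple (m := m) gm gx; last by exists m, y.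
exact: denq_prod_int.
Qed.

Lemma integral_multiple_exists (x : K) :
  exists m (y : integers K), m != 0 /\ integers_val y = m%:~R * x.
Proof.
have [g [gm gx _]] := embeddings_char_poly x.
pose m : int := \prod_(k < size g) denq g`_k.
have [|y yE] := integral_multiple (m := m) gm gx; last first.
  by exists m, y; split=> //; apply/prodf_neq0 => k _; exact: denq_neq0.
exact: denq_prod_int.
Qed.

End SplittingEmbeddings.

(** * Primes above a completely split prime number *)

Lemma bezout_intr (A : comNzRingType) (p : prime_number) (m : int) :
  ~~ (Posz (sval p) %| m)%Z -> exists a b : A, a * (sval p)%:R + b * m%:~R = 1.
Proof.
move=> pm; have : coprimez (Posz (sval p)) m.
  by rewrite coprimezE /= prime_coprime //; exact: (svalP p).
case/coprimezP => -[a b] /= ab; exists a%:~R, b%:~R.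
by have := congr1 (intr : int -> A) ab; rewrite intrD !intrM.
Qed.

Section PrimeOf.
Variables (K : etale) (P : prime_of K).
Implicit Types x y : integers K.

(** The quotient by a maximal ideal is a field: without an inverse of [x], the ideal [J] generated
    by [P] and [x] would be proper and larger than [P]. *)
Lemma prime_of_inv x : x \notin (P : idealr _) ->
  exists u, 1 - u * x \in (P : idealr _).
Proof.
move=> xP; apply: contrapT => h.
pose J (z : integers K) : bool := `[< exists a, z - a * x \in (P : idealr _) >].
have Jid : idealr_closed J.
  split.
  - by apply/asboolP; exists 0; rewrite mul0r subr0 rpred0.
  - by apply/negP => /asboolP.
  - move=> a u v /asboolP [b hb] /asboolP [c hc]; apply/asboolP.
    exists (a * b + c).
    rewrite (_ : _ - _ = a * (u - b * x) + (v - c * x)); last by ring.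
    by rewrite rpredD // idealMr.
have PJ : {subset prime_pred P <= J}.
  by move=> z zP; apply/asboolP; exists 0; rewrite mul0r subr0.
have := prime_maximal Jid PJ; move=> /(_ x) JP.
case/negP: xP; apply: JP; apply/asboolP; exists 1.
by rewrite mul1r subrr rpred0.
Qed.

Lemma prime_ofM x y :
  x * y \in (P : idealr _) -> x \in (P : idealr _) \/ y \in (P : idealr _).
Proof.
move=> xy; have [|xP] := boolP (x \in (P : idealr _)); first by left.
right; have [u hu] := prime_of_inv xP.
rewrite (_ : y = y * (1 - u * x) + u * (x * y)); last by ring.
by rewrite rpredD // idealMr.
Qed.

Lemma prime_of_prod (I : Type) (r : seq I) (F : I -> integers K) :
  (forall i, F i \notin (P : idealr _)) ->
  \prod_(i <- r) F i \notin (P : idealr _).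
Proof.
move=> h; elim: r => [|i r IH]; first by rewrite big_nil idealr1.
rewrite big_cons; apply/negP => /prime_ofM [] hh.
  by have := h i; rewrite hh.
by rewrite hh in IH.
Qed.

Lemma lies_above_intr p (m : int) : lies_above p P ->
  m%:~R \in (P : idealr (integers K)) -> (Posz (sval p) %| m)%Z.
Proof.
move=> pP mP; apply/negPn/negP => pm.
have [a [b ab]] := bezout_intr (integers K) pm.
have : (1 : integers K) \in (P : idealr _); last by rewrite idealr1.
by rewrite -ab rpredD // idealMr.
Qed.
End PrimeOf.

Lemma ideal_pow_exp (A : comNzRingType) (I : {pred A}) x N :
  x \in I -> x ^+ N \in ideal_pow I N.
Proof.
move=> xI; elim: N => [//|N IH]; apply/ideal_mulP.
exists [:: (x, x ^+ N)]; rewrite big_seq1 exprS; split=> // _ /[!inE] /eqP ->.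
by rewrite /= xI.
Qed.

Lemma ideal_pow_le (A : comNzRingType) (I : idealr A) M N :
  (M <= N)%N -> {subset ideal_pow I N <= ideal_pow I M}.
Proof.
by move=> /subnK <-; elim: (N - M)%N => [|k IH] x //; rewrite addSn => /ideal_powS /IH.
Qed.

(** Modulo [I ^ N] the product [z x] vanishes, so [x = (1 - z) x = (1 - z) ^ k x] for every [k], and
    [(1 - z) ^ N] lies in [I ^ N]. *)
Lemma ideal_pow_unit_mod (A : comNzRingType) (I : {pred A}) z x N :
  1 - z \in I -> z * x \in ideal_pow I N -> x \in ideal_pow I N.
Proof.
move=> zI zx.
suff h k : x - (1 - z) ^+ k * x \in ideal_pow I N.
  rewrite -[x](subrK ((1 - z) ^+ N * x)) ideal_pow_add //.
  by rewrite mulrC ideal_pow_mul // ideal_pow_exp.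
elim: k => [|k IH]; first by rewrite expr0 mul1r subrr ideal_pow_0.
rewrite (_ : _ - _ = x - (1 - z) ^+ k * x + (1 - z) ^+ k * (z * x)).
  by rewrite ideal_pow_add // ideal_pow_mul.
by rewrite exprS; ring.
Qed.

(** * Primes above p as inverse images of p Z_p under the embeddings *)

Section IntegersAbove.
Variables (K : etale) (p : prime_number).
Local Notation n := (\dim {: K}).
Local Notation Qp := (padic p).
Variable s : 'I_n -> {rmorphism K -> Qp}.
Hypothesis sP : splitting_embeddings s.

Definition int_emb i (x : integers K) : Qp := s i (integers_val x).

Lemma int_emb_zmod i : zmod_morphism (int_emb i).
Proof. by move=> x y; exact: (rmorphB (s i)). Qed.
Lemma int_emb_monoid i : monoid_morphism (int_emb i).
Proof. by split=> [|x y]; [exact: (rmorph1 (s i)) | exact: (rmorphM (s i))]. Qed.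

HB.instance Definition _ i := GRing.isZmodMorphism.Build (integers K) Qp
  (int_emb i) (int_emb_zmod i).
HB.instance Definition _ i := GRing.isMonoidMorphism.Build (integers K) Qp
  (int_emb i) (int_emb_monoid i).

Lemma int_emb_pdvd i x : pdvd 0 (int_emb i x).
Proof.
have /asboolP xi := integers_valP x.
(* A monic integer polynomial is chosen for each component, the default 1 being never taken. The
   product of these polynomials kills [x] in the whole of [K], so that the image of [x] in [Q_p] is
   a root of a single monic integer polynomial. *)
pose f k := if pselect (exists q : {poly int},
    q \is monic /\ root (map_poly intr q) (integers_val x k)) is left h
  then sval (cid h) else 1.
have fP k : f k \is monic /\ root (map_poly intr (f k)) (integers_val x k).
  rewrite /f; case: pselect => [h|[]]; first exact: (svalP (cid h)).
  by have [q qm qx] := xi k; exists q.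
pose q := \prod_k f k.
have qm : q \is monic by apply: monic_prod => k _; case: (fP k).
have qx : (map_poly intr q).[integers_val x] = 0.
  apply: functional_extensionality_dep => k.
  rewrite -[LHS]/(etale_proj k _) -horner_map /= -map_poly_comp /=.
  rewrite (eq_map_poly (g := intr)) => [|z]; last by rewrite /= rmorph_int.
  rewrite rmorph_prod horner_prod (bigD1 k) //=.
  by case: (fP k) => _ /rootP ->; rewrite mul0r.
apply: (@pdvd_root_monic _ (map_poly intr q)).
- exact: monic_map.
- by move=> k; rewrite coef_map; exact: pdvd_int.
apply/rootP; rewrite -[RHS](rmorph0 (s i)) -qx -horner_map -map_poly_comp /=.
by congr horner; apply: eq_map_poly => z; rewrite /= rmorph_int.
Qed.

(** Each p-adic coefficient [b] is replaced by a rational [q], so that [q *: a] lies in [K]. *)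
Lemma embeddings_approx (t : seq (K * Qp)) N :
  exists e, forall j, pdvd N (s j e - \sum_(ab <- t) s j ab.1 * ab.2).
Proof.
elim: t => [|[a b] t [e IH]].
  by exists 0 => j; rewrite big_nil rmorph0 subr0; exact: pdvd0.
have /boolp.choice [f fP] : forall j, exists r, pdvd 0 ((sval p ^ r)%:R * s j a).
  by move=> j; exact: pdvd_exists.
pose M := (\max_j f j)%N.
(* [p ^ M] clears the denominators of all the [s j a]; the extra precision [M] makes up for them. *)
have [q hq] := pdvd_approx_rat (M + N) b.
exists (e + q *: a) => j; rewrite big_cons rmorphD (embeddingZ sP) /=.
have identity (R : comPzRingType) (u v w b' z : R) :
  u + w * v - (v * b' + z) = u - z - v * (b' - w) by ring.
rewrite identity; apply: pdvdB => //.
apply: (proj1 (pdvd_natM M N _)); rewrite mulrA; apply: pdvdMl => //.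
have := fP j; have /subnK <- : (f j <= M)%N by exact: leq_bigmax.
by rewrite expnD natrM -mulrA; apply: pdvdMl; exact: pdvd_int (Posz _).
Qed.

(** An element of [K] close to the i-th idempotent of [Q_p ^ n] is made integral by a factor prime
    to [p], which affects neither condition. *)
Lemma embedding_idempotent i N : exists e : integers K,
  ~ pdvd 1 (int_emb i e) /\ forall j, j != i -> pdvd N (int_emb j e).
Proof.
have [_ /(_ i) [t tE]] := sP.
(* Precision [N.+1] is positive even for [N = 0], so that [s i e] is 1 modulo [p]. *)
have [e eP] := embeddings_approx t N.+1.
have e0 j : pdvd 0 (s j e).
  rewrite -[s j e](subrK (j == i)%:R) -tE; apply: pdvdD; first exact: pdvd_le (eP j).
  by rewrite tE; exact: pdvd_int (Posz _).
have [m [y [pm yE]]] := embeddings_integral sP e0.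
exists y; rewrite /int_emb yE; split=> [|j ji].
  rewrite rmorphM rmorph_int => /pdvd_prime [||/pdvd_intr|].
  - exact: pdvd_int.
  - exact: e0.
  - by rewrite expn1; apply/negP.
  move=> h; have := eP i; rewrite tE eqxx => /(pdvd_le (ltn0Sn N)) h'.
  by have := pdvdB h h'; rewrite subKr; exact: not_pdvd1.
rewrite rmorphM rmorph_int; apply: pdvdMl; first exact: pdvd_int.
by have := eP j; rewrite tE (negbTE ji) subr0; apply: pdvd_le.
Qed.

Lemma int_emb_approx N i x : exists k : int, pdvd N (int_emb i (x - k%:~R)).
Proof.
have [k hk] := pdvd_approx N (int_emb_pdvd i x); exists k.
by rewrite rmorphB rmorph_int.
Qed.

Lemma int_emb_div N (x : integers K) : (forall j, pdvd N (int_emb j x)) ->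
  exists m (y : integers K),
    ~~ (Posz (sval p) %| m)%Z /\ (sval p ^ N)%:R * y = m%:~R * x.
Proof.
move=> xN; have pN0 : (sval p ^ N)%:R != 0 :> rat.
  by rewrite pnatr_eq0 -lt0n pow_prime_gt0.
have [|m [y [pm yE]]] := embeddings_integral sP (x := (sval p ^ N)%:R^-1 *: integers_val x).
  move=> j; rewrite (embeddingZ sP); apply: (proj1 (pdvd_natM N 0 _)).
  rewrite addn0 mulrA -/(rat_to_padic p _) fmorphV rmorph_nat divff ?mul1r.
    exact: xN.
  by rewrite padic_natr_eq0 -lt0n pow_prime_gt0.
exists m, y; split=> //; apply: val_inj.
rewrite rmorphM rmorph_nat [RHS]rmorphM rmorph_int.
rewrite /= yE mulrCA; congr (_ * _).
by rewrite -scaler_nat -scalerAl mul1r scalerA divff // scale1r.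
Qed.

(** If no [i] satisfied the implication from right to left, elements [y i] outside [P] with
    [s i (y i)] in [p Z_p] would have a product that a factor prime to [p] turns into a multiple of
    [p], hence into an element of [P]. The other implication follows because [x] is an integer [k]
    modulo either ideal. *)
Lemma above_embedding (P : prime_of K) : lies_above p P ->
  exists i, forall x, x \in (P : idealr _) <-> pdvd 1 (int_emb i x).
Proof.
move=> pP.
have [i iP] : exists i, forall x, pdvd 1 (int_emb i x) -> x \in (P : idealr _).
  apply: contrapT => /forallNP h.
  have /boolp.choice [y yP] : forall i, exists x, pdvd 1 (int_emb i x) /\ x \notin (P : idealr _).
    move=> i; have /existsNP [x /not_implyP [h1 h2]] := h i.
    by exists x; split=> //; apply/negP.
  have [j|m [w [pm wE]]] := @int_emb_div 1 (\prod_i y i).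
    rewrite rmorph_prod (bigD1 j) //=; apply: pdvdMr; first by case: (yP j).
    by apply: pdvd_prod => k _; exact: int_emb_pdvd.
  have : m%:~R * \prod_i y i \in (P : idealr _).
    by rewrite -wE mulrC idealMr // expn1.
  case/prime_ofM => [/(lies_above_intr pP)|]; first by apply/negP.
  by apply/negP/prime_of_prod => i; case: (yP i).
exists i => x; split=> [xP|]; last exact: iP.
have [k hk] := int_emb_approx 1 i x.
have kP : k%:~R \in (P : idealr (integers K)).
  by rewrite -[k%:~R](subKr x) rpredB // iP.
rewrite -[x](subrK k%:~R) rmorphD; apply: pdvdD => //.
rewrite rmorph_int; apply/pdvd_intr; rewrite expn1.
exact: lies_above_intr kP.
Qed.

(** From right to left: with [e] nearly the i-th idempotent, all embeddings of [e x] are divisible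
    by [p ^ N]. Hence [m e x] is in [p ^ N O_K], thus in [P ^ N], and [m e] is invertible modulo
    [P]. *)
Lemma above_embedding_pow (P : prime_of K) i : lies_above p P ->
  (forall x, x \in (P : idealr _) <-> pdvd 1 (int_emb i x)) ->
  forall N x, x \in ideal_pow (P : idealr _) N <-> pdvd N (int_emb i x).
Proof.
move=> pP iP N x; split.
  elim: N x => [|N IH] x; first by move=> _; exact: int_emb_pdvd.
  move=> /ideal_mulP [t [ht ->]]; rewrite rmorph_sum big_seq.
  apply: pdvd_sum => ab /ht /andP[h1 h2]; rewrite rmorphM -add1n.
  by apply: pdvdM; [exact/iP | exact: IH].
move=> xN; have [e [ei ej]] := embedding_idempotent i N.
have [j|m [w [pm wE]]] := @int_emb_div N (e * x).
  rewrite rmorphM; have [->|ji] := eqVneq j i.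
    by apply: pdvdMl => //; exact: int_emb_pdvd.
  by apply: pdvdMr; [exact: ej | exact: int_emb_pdvd].
have meP : m%:~R * e \notin (P : idealr _).
  apply/negP => /prime_ofM [/(lies_above_intr pP)|/iP //].
  by apply/negP.
have [u hu] := prime_of_inv meP.
apply: (ideal_pow_unit_mod hu); rewrite -!mulrA -wE [_ * w]mulrC mulrA.
apply: ideal_pow_mul; rewrite natrX; exact: ideal_pow_exp.
Qed.

Lemma emb_prime_ideal i :
  idealr_closed (fun x : integers K => `[< pdvd 1 (int_emb i x) >]).
Proof.
split=> [||a x y /asboolP hx /asboolP hy].
- by apply/asboolP; rewrite rmorph0; exact: pdvd0.
- by apply/negP => /asboolP; rewrite rmorph1; exact: not_pdvd1.
apply/asboolP; rewrite rmorphD rmorphM; apply: pdvdD => //.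
by apply: pdvdMl => //; exact: int_emb_pdvd.
Qed.

(** Every [x] in [J] is an integer [k] modulo the smaller ideal. Both [p] and [k] lie in [J], so a
    [k] prime to [p] would put 1 in [J]. *)
Lemma emb_prime_maximal i (J : integers K -> bool) : idealr_closed J ->
  {subset (fun x : integers K => `[< pdvd 1 (int_emb i x) >]) <= J} ->
  {subset J <= (fun x : integers K => `[< pdvd 1 (int_emb i x) >])}.
Proof.
move=> [J0 J1 JD] sub x xJ; apply/asboolP.
have [k hk] := int_emb_approx 1 i x.
have xk : x - k%:~R \in J by apply: sub; apply/asboolP.
have kJ : k%:~R \in J.
  by have := JD (-1) _ _ xk xJ; rewrite mulN1r opprB subrK.
rewrite -[x](subrK k%:~R) rmorphD; apply: pdvdD => //.
rewrite rmorph_int; apply/pdvd_intr; rewrite expn1.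
apply/negPn/negP => pk; case/negP: J1.
have [a [b ab]] := bezout_intr (integers K) pk.
have pJ : (sval p)%:R \in J.
  by apply: sub; apply/asboolP; rewrite rmorph_nat -[sval p]expn1; exact: pdvd_pp.
have apJ : a * (sval p)%:R \in J by have := JD a _ _ pJ J0; rewrite addr0.
by rewrite -ab addrC; exact: JD.
Qed.

Definition emb_prime i := PrimeOf (emb_prime_ideal i) (@emb_prime_maximal i).

Lemma emb_prime_above i : lies_above p (emb_prime i).
Proof. by apply/asboolP; rewrite rmorph_nat -[sval p]expn1; exact: pdvd_pp. Qed.

End IntegersAbove.

(** * Topology and Haar measure of completions *)

Section CompletionTopology.
Variables (A : comNzRingType) (I : idealr A).
Implicit Types (x y z : completion I) (a b : A) (u v : coherent_seq I).
Local Notation of_seq := (\pi_({ideal_quot (@null_seq A I)})).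

Lemma pi_coherent_seq u v : of_seq u = of_seq v ->
  forall n, u n - v n \in ideal_pow I n.
Proof. by move/eqP; rewrite piE equivE => /null_seqP h n; have := h n. Qed.

Lemma repr_completion_of a n :
  (repr (completion_of I a) : coherent_seq I) n - a \in ideal_pow I n.
Proof.
have := @pi_coherent_seq (repr (completion_of I a)) (CoherentSeq (const_coherent I a)).
by move=> /(_ (reprK _) n).
Qed.

Lemma repr_completionD x y n : (repr (x + y) : coherent_seq I) n
  - ((repr x : coherent_seq I) n + (repr y : coherent_seq I) n) \in ideal_pow I n.
Proof.
have h : of_seq (repr (x + y)) = of_seq (repr x + repr y : coherent_seq I).
  rewrite rmorphD.
  exact: etrans (reprK _) (esym (congr2 +%R (reprK x) (reprK y))).
exact: (pi_coherent_seq h n).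
Qed.

Lemma completion_ball_refl x n : completion_ball x n x.
Proof. by rewrite /completion_ball /= subrr ideal_pow_0. Qed.

Lemma completion_ball_sym x y n : completion_ball x n y -> completion_ball y n x.
Proof.
rewrite /completion_ball /= => h; rewrite -opprB -sub0r.
by apply: ideal_pow_sub h; exact: ideal_pow_0.
Qed.

Lemma completion_ball_trans x y z n :
  completion_ball x n y -> completion_ball y n z -> completion_ball x n z.
Proof.
rewrite /completion_ball /= => h1 h2.
by rewrite -(subrKA ((repr y : coherent_seq I) n)) ideal_pow_add.
Qed.

Lemma completion_ball_of a b n :
  completion_ball (completion_of I a) n (completion_of I b) <->
  b - a \in ideal_pow I n.
Proof.
rewrite /completion_ball /=.
have ha := repr_completion_of a n; have hb := repr_completion_of b n.
move: ((repr (completion_of I a) : coherent_seq I) n) ha => ra ha.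
move: ((repr (completion_of I b) : coherent_seq I) n) hb => rb hb.
split=> h.
  rewrite (_ : b - a = (rb - ra) + (ra - a) - (rb - b)); last by ring.
  by rewrite ideal_pow_sub // ideal_pow_add.
rewrite (_ : rb - ra = (b - a) + (rb - b) - (ra - a)); last by ring.
by rewrite ideal_pow_sub // ideal_pow_add.
Qed.

Lemma completion_ball_dense x n : exists a, completion_ball (completion_of I a) n x.
Proof.
exists ((repr x : coherent_seq I) n); rewrite /completion_ball /=.
rewrite -opprB -sub0r ideal_pow_sub ?ideal_pow_0 //.
exact: repr_completion_of.
Qed.

Lemma completion_ball_translate x y n :
  completion_ball (x + y) n = [set x + z | z in completion_ball y n].
Proof.
have key z w : (repr (x + w) : coherent_seq I) n - (repr (x + z) : coherent_seq I) n
    \in ideal_pow I n <->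
    (repr w : coherent_seq I) n - (repr z : coherent_seq I) n \in ideal_pow I n.
  have := repr_completionD x w n; have := repr_completionD x z n.
  move: ((repr (x + w) : coherent_seq I) n) ((repr (x + z) : coherent_seq I) n)
    ((repr x : coherent_seq I) n) ((repr w : coherent_seq I) n)
    ((repr z : coherent_seq I) n) => xw xz x' w' z' hz hw.
  split=> h.
    rewrite (_ : w' - z' = (xw - xz) + (xz - (x' + z')) - (xw - (x' + w'))); last by ring.
    by rewrite ideal_pow_sub // ideal_pow_add.
  rewrite (_ : xw - xz = (w' - z') + (xw - (x' + w')) - (xz - (x' + z'))); last by ring.
  by rewrite ideal_pow_sub // ideal_pow_add.
apply/seteqP; split=> [w hw|w [z hz <-]]; last exact/key.
exists (w - x); last by rewrite addrC subrK.
by apply/key; rewrite [x + (w - x)]addrC subrK.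
Qed.

Lemma open_completion_ball x n : open (completion_ball x n : set (completion I)).
Proof.
move=> y xy; exists n => z yz; exact: completion_ball_trans xy yz.
Qed.

Lemma open_completion_ball_sub (U : set (completion I)) x : open U -> U x ->
  exists n, completion_ball x n `<=` U.
Proof. by move=> oU Ux; exact: oU. Qed.

(** Such a [U] is a union of fibres of the projection to [A / I ^ n]. *)
Definition ball_stable n (U : set (completion I)) :=
  forall x y, U x -> completion_ball x n y -> U y.

Lemma ball_stable_le m n U : (m <= n)%N -> ball_stable m U -> ball_stable n U.
Proof.
by move=> mn h x y Ux xy; apply: (h x) => //; exact: completion_ball_le xy.
Qed.

(** Finitely many balls inside [U] cover it. Every point of a ball is a centre of it, so the largest
    of their exponents works for all points. *)
Lemma compact_open_stable (U : set (completion I)) :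
  compact U -> open U -> exists n, ball_stable n U.
Proof.
rewrite compact_cover => cU oU.
have /boolp.choice [r rP] : forall x, exists n, U x -> completion_ball x n `<=` U.
  move=> x; have [Ux|nUx] := pselect (U x); last by exists 0%N.
  by have [n hn] := open_completion_ball_sub oU Ux; exists n.
have [|x Ux|D DU cov] := cU (completion I) U (fun x => completion_ball x (r x)).
- by move=> x _; exact: open_completion_ball.
- by exists x => //; exact: completion_ball_refl.
exists (\max_(x <- D) r x)%N => x y Ux xy.
have [z /= zD zx] := cov x Ux.
apply: (rP z); first by apply: set_mem; exact: DU.
apply: completion_ball_trans zx _; apply: completion_ball_le xy.
by rewrite (big_rem z) //= leq_maxl.
Qed.

End CompletionTopology.

Section HaarCount.
Variables (A : comNzRingType) (I : idealr A) (RT : realType).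
Variables (mu : probability (borel_completion I) RT).
Hypothesis mu_haar : haar mu.
Variables (N q : nat).
Hypothesis cover_q : forall a : A, exists2 t, (t < q)%N & a - t%:R \in ideal_pow I N.
Hypothesis inj_q : forall t t', (t < q)%N -> (t' < q)%N ->
  t%:R - t'%:R \in ideal_pow I N -> t = t'.

Lemma measurable_completion_open (U : set (completion I)) : open U ->
  (measurable : set (set (borel_completion I))) U.
Proof. move=> oU; apply: sub_gen_smallest; exact oU. Qed.

Lemma measurable_completion_ball x n :
  (measurable : set (set (borel_completion I))) (completion_ball x n).
Proof. exact (measurable_completion_open (@open_completion_ball _ _ x n)). Qed.

(** The numbers [t < q] represent [A / I ^ N]. The [q] balls around the [a + t] are therefore a
    partition into translates of one ball, each of measure [1 / q]; those with centre in [U] lie in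
    [U]. *)
Lemma haar_stable_count (U : set (completion I)) (a : A) :
  open U -> ball_stable N U ->
  (((\sum_(t < q) (`[< U (completion_of I (a + t%:R)) >] : nat)%:R)%R : RT)%:E
    <= q%:R%:E * mu U)%E.
Proof.
move=> oU sU.
pose b (t : 'I_q) : set (borel_completion I) :=
  completion_ball (completion_of I (a + t%:R)) N.
have mb t : measurable (b t) by exact: measurable_completion_ball.
have bE t : mu (b t) = mu (completion_ball (completion_of I 0) N : set (borel_completion I)).
  rewrite /b -[completion_of I (a + _)]addr0 completion_ball_translate.
  rewrite rmorph0; exact: (mu_haar _ (measurable_completion_ball 0 N)).
have tb : trivIset setT b.
  apply/trivIsetP => t t' _ _ tt'; apply/eqP/negPn/negP => /set0P [x [h1 h2]].
  have := completion_ball_trans h2 (completion_ball_sym h1).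
  move/completion_ball_of; rewrite opprD addrACA subrr add0r => h.
  by case/eqP: tt'; apply: val_inj; exact: (inj_q (ltn_ord t) (ltn_ord t')).
set m := mu _ in bE.
have one : (q%:R%:E * m = 1)%E.
  rewrite -(probability_setT mu).
  have -> : setT = \big[setU/set0]_(t < q) b t.
    apply/esym/seteqP; split=> // x _; rewrite -(bigcup_pred predT).
    have [c hc] := completion_ball_dense x N.
    have [t tq ht] := cover_q (c - a).
    exists (Ordinal tq) => //; apply: completion_ball_trans hc.
    by apply/completion_ball_of; rewrite opprD addrA.
  rewrite measure_bigsetU_ord //.
  rewrite (eq_bigr (fun=> m)); last by move=> t _; exact: bE.
  by rewrite sumr_const card_ord mule_natl.
pose P t := `[< U (completion_of I (a + t%:R)) >].
have sub : \big[setU/set0]_(t < q | P t) b t `<=` U.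
  rewrite -bigcup_pred => x [t /asboolP Ut]; exact: sU.
have : (\sum_(t < q | P t) mu (b t) <= mu U)%E.
  rewrite -measure_bigsetU_ord //; apply: le_measure => //; apply: mem_set.
    by apply: bigsetU_measurable => t _; exact: mb.
  exact (measurable_completion_open oU).
rewrite (eq_bigr (fun=> m)); last by move=> t _; exact: bE.
have mfin : m \is a fin_num by apply: fin_num_measure; exact: measurable_completion_ball.
have ufin : mu U \is a fin_num.
  by apply: fin_num_measure; exact (measurable_completion_open oU).
move: one; rewrite -(fineK mfin) -(fineK ufin) -EFinM => -[one].
rewrite sumEFin !lee_fin => le_u.
rewrite (_ : \sum_(t < q) _ = q%:R * \sum_(t < q | P t) fine m)%R.
  by apply: ler_wpM2l.
rewrite mulr_sumr [RHS]big_mkcond; apply: eq_bigr => t _.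
by rewrite one /P; case: asboolP.
Qed.

End HaarCount.

(** * Avoiding a sieve *)

Section Averaging.
Variables (V : zmodType) (RT : realDomainType) (T : eqType) (q : nat) (h : T -> V).
Implicit Types (f g : V -> RT) (y z : V) (s : seq T).

(* The sum of [f] over the points [y + sum_P t_P h_P], with [t_P < q]. *)
Fixpoint box_sum s f y : RT :=
  if s is P :: s' then \sum_(t < q) box_sum s' f (y + h P *+ t) else f y.

Lemma box_sum_shift s f y v :
  box_sum s f (y + v) = box_sum s (fun z => f (z + v)) y.
Proof.
elim: s y => [//|P s IH] y /=; apply: eq_bigr => t _.
by rewrite -IH addrAC.
Qed.

Lemma box_sum_sum (J : Type) (r : seq J) (F : J -> V -> RT) s y :
  box_sum s (fun z => \sum_(j <- r) F j z) y = \sum_(j <- r) box_sum s (F j) y.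
Proof.
elim: s y => [//|P s IH] y /=.
by rewrite exchange_big /=; apply: eq_bigr => t _; exact: IH.
Qed.

Lemma box_sum_const s c y : box_sum s (fun=> c) y = q%:R ^+ size s * c.
Proof.
elim: s y => [|P s IH] y /=; first by rewrite mul1r.
rewrite (eq_bigr (fun=> q%:R ^+ size s * c)) => [|t _]; last exact: IH.
by rewrite sumr_const card_ord exprS -mulrA mulr_natl.
Qed.

Lemma box_sum_le s f g y : (forall z, f z <= g z) -> box_sum s f y <= box_sum s g y.
Proof.
by move=> fg; elim: s y => [|P s IH] y //=; apply: ler_sum => t _; exact: IH.
Qed.

(** The sum in the direction of [P] can be taken innermost, where the bound [q c] applies at every
    point of the remaining box. *)
Lemma box_sum_ub s f P c y : P \in s ->
  (forall z, \sum_(t < q) f (z + h P *+ t) <= q%:R * c) ->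
  box_sum s f y <= q%:R ^+ size s * c.
Proof.
move=> Ps fc; elim: s Ps y => [//|P' s IH]; rewrite inE.
case/orP => [/eqP <-|/IH {}IH] y /=; last first.
  apply: le_trans (ler_sum _ (fun t _ => IH _)) _.
  by rewrite sumr_const card_ord exprS -mulrA mulr_natl.
under eq_bigr do rewrite box_sum_shift.
rewrite -(box_sum_sum _ (fun (t : 'I_q) z => f (z + h P *+ t))).
apply: le_trans (box_sum_le _ _ fc) _.
by rewrite box_sum_const mulrA -exprSr.
Qed.

(** The average over the box is below 1. The coordinates are fixed one at a time, each time keeping
    an average below 1 over the remaining box. *)
Lemma box_sum_lt s f y (H : V -> Prop) :
  H 0 -> (forall u v, H u -> H v -> H (u + v)) -> (forall P, P \in s -> H (h P)) ->
  box_sum s f y < q%:R ^+ size s -> exists z, H (z - y) /\ f z < 1.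
Proof.
move=> H0 HD Hh; elim: s y Hh => [|P s IH] y Hh /=.
  by move=> fy; exists y; rewrite subrr.
move=> lt.
have [t ht] : exists t : 'I_q, box_sum s f (y + h P *+ t) < q%:R ^+ size s.
  apply: contrapT => /forallNP ge; move: lt; apply/negP; rewrite -leNgt exprS.
  apply: (@le_trans _ _ (\sum_(t < q) q%:R ^+ size s)).
    by rewrite sumr_const card_ord mulr_natl.
  by apply: ler_sum => t _; rewrite leNgt; apply/negP/ge.
have [P' P's|z [Hz fz]] := IH (y + h P *+ t) _ ht.
  by apply: Hh; rewrite inE P's orbT.
exists z; split=> //; rewrite (_ : z - y = z - (y + h P *+ t) + h P *+ t); last first.
  by rewrite opprD addrA subrK.
have HP k : H (h P *+ k).
  elim: k => [//|k HP]; rewrite mulrS.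
  by apply: HD => //; apply: Hh; rewrite mem_head.
exact: HD.
Qed.

End Averaging.

Lemma prime_of_eq (K : etale) (P Q : prime_of K) :
  (forall x, x \in (P : idealr _) <-> x \in (Q : idealr _)) -> P = Q.
Proof.
case: P Q => [P iP mP] [Q iQ mQ] PQ.
have E : P = Q by apply/funext => x; apply/idP/idP => h; apply/(PQ x).
by case: _ / E iQ mQ {PQ} => iQ mQ; congr PrimeOf; exact: Prop_irrelevance.
Qed.

Section PrimesAbove.
Variables (K : etale) (p : prime_number).
Variable s : 'I_(\dim {: K}) -> {rmorphism K -> padic p}.
Hypothesis sP : splitting_embeddings s.
Implicit Types (P : prime_of K) (x : integers K).

Lemma finite_primes_above : finite_set [set P : prime_of K | lies_above p P].
Proof.
apply: (@sub_finite_set _ _ (range (@emb_prime _ _ s))); last exact: finite_image.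
move=> P /= pP; have [i iP] := above_embedding sP pP.
exists i => //; apply/esym/prime_of_eq => x; split=> [/iP h|/asboolP h].
  exact/asboolP.
exact/iP.
Qed.

Lemma above_approx P N x : lies_above p P ->
  exists k : int, x - k%:~R \in ideal_pow (P : idealr _) N.
Proof.
move=> pP; have [i iP] := above_embedding sP pP.
have [k hk] := int_emb_approx s N i x; exists k.
exact/(above_embedding_pow sP pP iP).
Qed.

Lemma above_intr_pow P N (k : int) : lies_above p P ->
  k%:~R \in ideal_pow (P : idealr (integers K)) N <-> (Posz (sval p ^ N) %| k)%Z.
Proof.
move=> pP; have [i iP] := above_embedding sP pP.
rewrite (above_embedding_pow sP pP iP) rmorph_int; exact: pdvd_intr.
Qed.

Lemma above_unit_inv P N x : lies_above p P -> x \notin (P : idealr _) ->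
  exists k : int, k%:~R * x - 1 \in ideal_pow (P : idealr _) N.
Proof.
move=> pP xP; have [i iP] := above_embedding sP pP.
have [|k hk] := pdvd_unit_inv N (int_emb_pdvd s i x).
  by move=> /iP h; rewrite h in xP.
exists k; apply/(above_embedding_pow sP pP iP).
by rewrite rmorphB rmorphM rmorph_int rmorph1.
Qed.

Lemma above_cover P N x : lies_above p P ->
  exists2 t, (t < sval p ^ N)%N & x - t%:R \in ideal_pow (P : idealr _) N.
Proof.
move=> pP; have [k hk] := above_approx N x pP.
have q0 : Posz (sval p ^ N) != 0 by rewrite eqz_nat -lt0n pow_prime_gt0.
pose t := `|(k %% Posz (sval p ^ N))%Z|%N.
have tE : Posz t = (k %% Posz (sval p ^ N))%Z by rewrite gez0_abs ?modz_ge0.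
exists t.
  by rewrite -ltz_nat tE ltz_pmod // ltz_nat pow_prime_gt0.
rewrite (_ : x - t%:R = (x - k%:~R) + (k - Posz t)%:~R); last first.
  by rewrite rmorphB addrA subrK.
apply: ideal_pow_add => //; apply/above_intr_pow => //.
by rewrite tE {1}(divz_eq k (Posz (sval p ^ N))) addrK dvdz_mull.
Qed.

Lemma above_inj P N t t' : lies_above p P -> (t < sval p ^ N)%N ->
  (t' < sval p ^ N)%N -> t%:R - t'%:R \in ideal_pow (P : idealr (integers K)) N ->
  t = t'.
Proof.
move=> pP tq t'q.
rewrite (_ : _ - _ = (Posz t - Posz t')%:~R); last by rewrite rmorphB.
move/(above_intr_pow _ _ pP); rewrite dvdzE /= => /dvdn_leq.
lia.
Qed.

Section AvoidSieve.
Variables (RT : realType) (R : sieve K).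
Variable meas : forall P : prime_of K, probability (borel_completion P) RT.
Hypothesis meas_haar : forall P : prime_of K, haar (meas P).
Hypothesis meas_lt1 :
  (\esum_(P in [set P : prime_of K | lies_above p P]) meas P (R P) < 1)%E.

Lemma sieve_stable : exists N0, forall N, (N0 <= N)%N ->
  forall P, lies_above p P -> ball_stable N (R P).
Proof.
have /boolp.choice [r rP] : forall P, exists n, ball_stable n (R P).
  by move=> P; apply: compact_open_stable; [exact: sieve_compact | exact: sieve_open].
exists (\max_(P <- fset_set [set P : prime_of K | lies_above p P]) r P)%N.
move=> N rN P pP; apply: ball_stable_le (rP P); apply: leq_trans rN.
have Pf : P \in fset_set [set P : prime_of K | lies_above p P].
  by rewrite in_fset_set; [exact: mem_set | exact: finite_primes_above].
by rewrite (big_rem P) //= leq_maxl.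
Qed.

(** A union bound: [F P] is the indicator of landing in [R P], and its average over the box is at
    most the measure of [R P]. The predicate [H] carries a side condition that every step [h P]
    respects. *)
Lemma avoid_sieve N (h : prime_of K -> integers K) (H : integers K -> Prop) y :
  (forall P, lies_above p P -> ball_stable N (R P)) ->
  H 0 -> (forall u v, H u -> H v -> H (u + v)) ->
  (forall P, lies_above p P -> H (h P) /\ h P - 1 \in ideal_pow (P : idealr _) N) ->
  exists x, H (x - y) /\
    forall P, lies_above p P -> ~ R P (completion_of (P : idealr _) x).
Proof.
move=> Rst H0 HD hP.
pose S : seq (prime_of K) := fset_set [set P : prime_of K | lies_above p P].
have SP P : P \in S -> lies_above p P.
  by rewrite in_fset_set => [/set_mem //|]; exact: finite_primes_above.
have PS P : lies_above p P -> P \in S.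
  by move=> pP; rewrite in_fset_set; [exact: mem_set | exact: finite_primes_above].
pose F P x : RT := (`[< R P (completion_of (P : idealr _) x) >] : nat)%:R.
pose r P : RT := fine (meas P (R P)).
have rE P : meas P (R P) = (r P)%:E.
  rewrite fineK //; apply: fin_num_measure.
  exact (measurable_completion_open (@sieve_open _ R P)).
have r1 : \sum_(P <- S) r P < 1.
  rewrite -lte_fin -sumEFin; apply: le_lt_trans meas_lt1.
  rewrite esum_fset; [|exact: finite_primes_above|by move=> P _; exact: measure_ge0].
  rewrite fsbig_finite; last exact: finite_primes_above.
  by under [leRHS]eq_bigr do rewrite rE.
have Fub P y' : P \in S ->
    \sum_(t < sval p ^ N) F P (y' + h P *+ t) <= (sval p ^ N)%:R * r P.
  move=> /SP pP.
  have := haar_stable_count (@meas_haar P) (fun x => above_cover N x pP)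
    (fun t t' => @above_inj P N t t' pP) y' (@sieve_open _ R P) (Rst P pP).
  rewrite rE lee_fin; apply: le_trans; apply: ler_sum => t _.
  rewrite ler_nat /=.
  (* As [h P] is 1 modulo [P ^ N], the steps by [h P] run through the same classes as steps by 1,
     which are the ones counted by [haar_stable_count]. *)
  have b : completion_ball (completion_of (P : idealr _) (y' + h P *+ t)) N
             (completion_of (P : idealr _) (y' + t%:R)).
    apply/completion_ball_of; rewrite opprD addrACA subrr add0r.
    have [_ h1] := hP P pP.
    rewrite (_ : _ - _ = 0 - t%:R * (h P - 1)); last first.
      by rewrite mulrBr mulr1 mulr_natl sub0r opprB.
    by rewrite ideal_pow_sub ?ideal_pow_0 // ideal_pow_mul.
  case: asboolP => // /(Rst P pP)/(_ b) h2.
  by case: asboolP.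
have [z [Hz Fz]] : exists z, H (z - y) /\ \sum_(P <- S) F P z < 1.
  apply: (@box_sum_lt _ _ _ (sval p ^ N) h S) => // [P /SP /hP [] //|].
  rewrite box_sum_sum.
  apply: le_lt_trans (_ : _ <= \sum_(P <- S) (sval p ^ N)%:R ^+ size S * r P) _.
    rewrite big_seq [leRHS]big_seq; apply: ler_sum => P PSs.
    by apply: (box_sum_ub (P := P)) => // y'; exact: Fub.
  rewrite -mulr_sumr -[ltRHS]mulr1 ltr_pM2l // exprn_gt0 //.
  by rewrite ltr0n pow_prime_gt0.
(* A sum of indicators that is less than 1 has no term equal to 1. *)
exists z; split=> // P pP RPz.
have : F P z <= \sum_(P <- S) F P z.
  rewrite (big_rem P) ?PS //= lerDl; apply: sumr_ge0 => Q _; exact: ler0n.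
rewrite /F; case: asboolP => // _ /le_lt_trans /(_ Fz).
by rewrite ltxx.
Qed.

End AvoidSieve.
End PrimesAbove.

(** * Rigidity *)

Lemma etale_intr_mulI (K : etale) (m : int) (u v : K) :
  m != 0 -> m%:~R * u = m%:~R * v -> u = v.
Proof.
move=> m0; rewrite !mulrzl -!scaler_int; apply: scalerI.
by rewrite intr_eq0.
Qed.

Definition idem_val (K : etale) (j : 'I_(etale_deg K).+1) : K :=
  fun i => (i == j)%:R.

Lemma idem_valP (K : etale) j : idem_val j \in @integral_elts K.
Proof. by apply/asboolP => i; exact: integral_nat. Qed.

Definition idem (K : etale) j : integers K := Integers (@idem_valP K j).

Lemma idem_mulE (K : etale) j (x : integers K) i :
  integers_val (idem j * x) i = if i == j then integers_val x i else 0.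
Proof.
rewrite -[LHS]/((i == j)%:R * integers_val x i).
by case: eqP => _; rewrite ?mul1r ?mul0r.
Qed.

Lemma idem_mul_eq0 (K : etale) j (x : integers K) :
  integers_val x j = 0 -> idem j * x = 0.
Proof.
move=> x0; apply/val_inj/functional_extensionality_dep => i.
by rewrite [LHS]idem_mulE; case: eqP => // ->.
Qed.

Lemma idem_idem (K : etale) j : idem j * (1 - idem j) = 0 :> integers K.
Proof.
apply: idem_mul_eq0; rewrite -[LHS]/(1 - (j == j)%:R) eqxx; exact: subrr.
Qed.

(** The second condition says that [Q] comes from the j-th factor. Some embedding is nonzero on the
    idempotent and so maps it to 1; the prime of this embedding omits [idem j], hence contains
    [1 - idem j]. *)
Lemma prime_above_idem (K : etale) p (j : 'I_(etale_deg K).+1) :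
  splits_completely K p ->
  exists2 Q : prime_of K, lies_above p Q & 1 - idem j \in (Q : idealr _).
Proof.
move=> /splits_completely_embeddings [s sP].
have [i si] : exists i, s i (idem_val j) != 0.
  apply: contrapT => /forallNP h.
  have : idem_val j = 0.
    by apply: (embeddings_inj sP) => i; apply/eqP/negPn/negP => /h.
  move=> /(congr1 (fun x : K => x j)); rewrite /idem_val eqxx => /eqP.
  by rewrite oner_eq0.
exists (emb_prime s i); first exact: emb_prime_above.
have : idem j * (1 - idem j) \in (emb_prime s i : idealr _).
  by rewrite idem_idem rpred0.
case/prime_ofM => // /asboolP h; exfalso.
have idem1 : s i (idem_val j) = 1.
  apply: (mulfI si); rewrite mulr1 -rmorphM; congr (s i _).
  apply: functional_extensionality_dep => k.
  rewrite -[LHS]/((k == j)%:R * (k == j)%:R) /idem_val.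
  by case: eqP => _; rewrite ?mulr1 ?mulr0.
by apply: (@not_pdvd1 p); rewrite -idem1.
Qed.

(** Since [z] is nonzero, factors [X] can be removed from [q] until its constant term is nonzero;
    [c] is that term. *)
Lemma root_int_multiple (F : idomainType) (z : F) (q : {poly int}) :
  q != 0 -> root (map_poly intr q) z -> z != 0 ->
  exists (c : int) (r : {poly int}), c != 0 /\ z * (map_poly intr r).[z] = c%:~R.
Proof.
move=> q0 qz z0; elim/poly_ind: q q0 qz => [|q c IH]; first by rewrite eqxx.
have [->|c0] := eqVneq c 0; last first.
  move=> _ /rootP; rewrite rmorphD rmorphM /= map_polyX map_polyC hornerD hornerMX hornerC.
  move=> /(canRL (addrK _)) h; exists c, (- q); split=> //.
  by rewrite rmorphN hornerN mulrN mulrC h sub0r opprK.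
rewrite addr0 => qX; rewrite rmorphM /= map_polyX rootM rootX (negbTE z0) orbF.
by apply: IH; apply: contraNneq qX => ->; rewrite mul0r.
Qed.

(** A nonzero component [z_j] has a multiple that is a nonzero integer [c]. If [p] exceeds the
    absolute value of [c] and [Q] above [p] comes from the j-th factor, then [z] in [Q] forces [p]
    to divide [c]. *)
Lemma integers_eq0 (K : etale) (z : integers K) :
  (forall n, exists p : prime_number, [/\ (n < sval p)%N, splits_completely K p &
     forall Q : prime_of K, lies_above p Q -> z \in (Q : idealr _)]) -> z = 0.
Proof.
move=> h; apply/val_inj/functional_extensionality_dep => j.
apply/eqP/negPn/negP => zj0.
have /asboolP /(_ j) [q qm qz] := integers_valP z.
have [c [r [c0 rE]]] := root_int_multiple (monic_neq0 qm) qz zj0.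
have [p [pc split zQ]] := h `|c|%N.
have [Q pQ jQ] := prime_above_idem j split.
have : c%:~R \in (Q : idealr (integers K)); last first.
  move=> /(lies_above_intr pQ); rewrite dvdzE /= => /dvdn_leq.
  by rewrite absz_gt0 c0 => /(_ isT); rewrite leqNgt pc.
(* [d] vanishes in the component [j], so it is a multiple of [1 - idem j], which lies in [Q]. *)
set w := z * (map_poly intr r).[z]; set d := c%:~R - w.
have e0 : idem j * d = 0.
  apply: idem_mul_eq0; rewrite -[LHS]/((@etale_proj K j \o val) d) /d /w.
  rewrite rmorphB rmorphM rmorph_int -horner_map -map_poly_comp /=.
  rewrite (eq_map_poly (g := intr)) => [|k].
    by rewrite -[etale_proj j _]/(integers_val z j) rE subrr.
  exact: (rmorph_int (@etale_proj K j \o val)).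
have dQ : d \in (Q : idealr _).
  by rewrite (_ : d = d * (1 - idem j)) ?idealMr // mulrBr mulr1 mulrC e0 subr0.
have wQ : w \in (Q : idealr _) by rewrite /w mulrC idealMr // zQ.
by rewrite -[c%:~R](subrK w) rpredD.
Qed.

Lemma infinite_primes_gt (E : set prime_number) n :
  infinite_set E -> exists2 p, E p & (n < sval p)%N.
Proof.
move=> Einf; apply: contrapT => h; apply: Einf.
apply: (@sub_finite_set _ _ ((fun p : prime_number => sval p) @^-1` `I_n.+1)).
  move=> p Ep /=; rewrite ltnS leqNgt; apply/negP => np; apply: h; by exists p.
apply: finite_preimage (finite_II _) => p p' _ _; exact: val_inj.
Qed.

(** * Consequences of the hypotheses at one prime number *)

Section GoodPrime.
Variables (RT : realType) (K L : etale) (R : sieve K) (S : sieve L).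
Variable meas : forall P : prime_of K, probability (borel_completion P) RT.
Hypothesis meas_haar : forall P : prime_of K, haar (meas P).
Variable A : {additive integers K -> integers L}.
Variable p : prime_number.
Hypothesis unsievedA : p_map p A @` unsieved R p `<=` unsieved S p.
Hypothesis sieve_meets : forall Q : prime_of L, lies_above p Q ->
  [set completion_of Q (A a) | a in setT] `&` S Q !=set0.
Hypothesis meas_lt1 :
  (\esum_(P in [set P : prime_of K | lies_above p P]) meas P (R P) < 1)%E.
Hypotheses (splitK : splits_completely K p) (splitL : splits_completely L p).

Lemma p_component_pure1 (M : etale) (P : prime_of M) (hP : lies_above p P) x :
  p_component hP (pure _ _ x 1) = completion_of (P : idealr _) x.
Proof. by rewrite p_component_pure rmorph1 mulr1. Qed.

Lemma avoid_image (x : integers K) :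
  (forall P, lies_above p P -> ~ R P (completion_of (P : idealr _) x)) ->
  forall Q, lies_above p Q -> ~ S Q (completion_of (Q : idealr _) (A x)).
Proof.
move=> xR Q pQ.
have Ax : unsieved S p (pure _ _ (A x) 1).
  apply: unsievedA; exists (pure _ _ x 1); last exact: p_map_pure.
  by move=> P pP; rewrite p_component_pure1; exact: xR.
by have := Ax Q pQ; rewrite p_component_pure1.
Qed.

Lemma good_prime_factor Q : lies_above p Q -> exists P N, lies_above p P /\
  forall u, u \in ideal_pow (P : idealr _) N -> A u \in (Q : idealr _).
Proof.
move=> pQ; apply: contrapT => no_factor.
have [s sP] := splits_completely_embeddings splitK.
have [s' sP'] := splits_completely_embeddings splitL.
have [_ [[a _ <-] SAa]] := sieve_meets pQ.
have [n nS] := open_completion_ball_sub (@sieve_open _ S Q) SAa.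
have [N0 N0R] := sieve_stable sP R.
pose N := maxn N0 n.
have /boolp.choice [h hP] : forall P, exists h, lies_above p P ->
    A h \in ideal_pow (Q : idealr _) N /\ h - 1 \in ideal_pow (P : idealr _) N.
  move=> P; have [pP|npP] := pselect (lies_above p P); last by exists 0.
  have [u [uP AuQ]] : exists u, u \in ideal_pow (P : idealr _) N /\ A u \notin (Q : idealr _).
    apply: contrapT => /forallNP hu; apply: no_factor; exists P, N; split=> // u uP.
    by apply/negPn/negP => AuQ; apply: (hu u).
  have [k' hk'] := above_unit_inv sP' N pQ AuQ.
  have [l hl] := above_approx sP' N (A 1) pQ.
  (* Modulo [Q ^ N], the integer [k'] inverts [A u] and [l] equals [A 1], so the image
     [A 1 - l k' A u] vanishes; modulo [P ^ N] the element is 1 because [u] is in [P ^ N]. *)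
  exists (1 - (l * k')%:~R * u) => _; split.
    rewrite raddfB mulrzl raddfMz -mulrzl intrM.
    rewrite (_ : _ - _ = (A 1 - l%:~R) - l%:~R * (k'%:~R * A u - 1)); last by ring.
    by rewrite ideal_pow_sub // ideal_pow_mul.
  rewrite addrC addKr -sub0r ideal_pow_sub ?ideal_pow_0 //.
  exact: ideal_pow_mul.
have [|||P pP|x [Ax xR]] := avoid_sieve sP (N := N) (h := h)
    (H := fun x => A x \in ideal_pow (Q : idealr _) N) meas_haar meas_lt1 a.
- by move=> P pP; apply: N0R => //; exact: leq_maxl.
- by rewrite raddf0 ideal_pow_0.
- by move=> u v hu hv; rewrite raddfD ideal_pow_add.
- exact: hP.
(* The point [x] avoids all the [R P], yet [A x] is so close to [A a] that it lies in [S Q]. *)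
apply: (avoid_image xR pQ); apply: nS; apply/completion_ball_of.
by rewrite -raddfB; apply: ideal_pow_le Ax; exact: leq_maxr.
Qed.

Lemma good_prime_mul Q x y : lies_above p Q ->
  A (x * y) * A 1 - A x * A y \in (Q : idealr _).
Proof.
move=> pQ; have [P [N [pP AP]]] := good_prime_factor pQ.
have [s sP] := splits_completely_embeddings splitK.
have [k xk] := above_approx sP N x pP.
have h1 := AP _ xk.
have h2 : A ((x - k%:~R) * y) \in (Q : idealr _).
  by apply: AP; rewrite mulrC ideal_pow_mul.
have Aint u : A (k%:~R * u) = k%:~R * A u by rewrite mulrzl raddfMz mulrzl.
(* Taken with [e] the integer [k], this expresses the difference through [A ((x - k) y)] and
   [A (x - k)], both in [Q]. *)
have identity (B : comPzRingType) (a b c d e : B) :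
  a * b - c * d = b * (a - e * d) - d * (c - e * b) by ring.
rewrite (identity _ _ _ _ _ k%:~R) -!Aint mulr1 -!raddfB -mulrBl.
by rewrite rpredB // idealMr.
Qed.

Lemma good_prime_unit j :
  ~ (forall x, integers_val (A x) j = 0).
Proof.
move=> Aj0.
have [Q pQ jQ] := prime_above_idem j splitL.
have [s sP] := splits_completely_embeddings splitK.
(* [idem j] kills [A x] and is 1 modulo [Q], so [A x] lies in every power of [Q]. *)
have AQ x n : A x \in ideal_pow (Q : idealr _) n.
  by apply: ideal_pow_unit_mod jQ _; rewrite idem_mul_eq0 // ideal_pow_0.
have [_ [[a _ <-] SAa]] := sieve_meets pQ.
have [n nS] := open_completion_ball_sub (@sieve_open _ S Q) SAa.
have [N0 N0R] := sieve_stable sP R.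
(* Any point avoiding the [R P] will do, since all values of [A] agree in the completion at [Q];
   hence the steps 1 and the trivial condition [H]. *)
have [|||P pP|x [_ xR]] := avoid_sieve sP (N := N0) (h := fun=> 1)
    (H := fun=> True) meas_haar meas_lt1 0 => //.
- exact: N0R.
- by split=> //; rewrite subrr ideal_pow_0.
apply: (avoid_image xR pQ); apply: nS; apply/completion_ball_of.
by rewrite ideal_pow_sub.
Qed.

End GoodPrime.

(** * The algebra homomorphism obtained by dividing by A 1 *)

Section HomFromIntegers.
Variables (K L : etale) (A : {additive integers K -> integers L}).
Hypothesis A_mul : forall x y, A (x * y) * A 1 = A x * A y.
Hypothesis A1_unit : forall j, integers_val (A 1) j != 0.
Hypothesis K_frac : forall x : K,
  exists m (y : integers K), m != 0 /\ integers_val y = m%:~R * x.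
Local Notation eps := (integers_val (A 1)).

(* The graph of [x |-> A x / eps], extended to [K] by clearing denominators. *)
Definition quotient_value (x : K) (t : L) : Prop := exists m (y : integers K),
  [/\ m != 0, integers_val y = m%:~R * x & m%:~R * (eps * t) = integers_val (A y)].

Lemma eps_mulI (u v : L) : eps * u = eps * v -> u = v.
Proof.
move=> uv; apply: functional_extensionality_dep => j.
by apply: (mulfI (A1_unit j)); exact: (congr1 (fun x : L => x j) uv).
Qed.

Lemma A_intr_mul (m : int) y :
  integers_val (A (m%:~R * y)) = m%:~R * integers_val (A y).
Proof.
rewrite mulrzl raddfMz -mulrzl.
exact: etrans (rmorphM val _ _) (congr1 ( *%R^~ _) (rmorph_int val m)).
Qed.

Lemma quotient_value_exists x : exists t, quotient_value x t.
Proof.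
have [m [y [m0 yE]]] := K_frac x.
exists (fun j => m%:~R^-1 * (integers_val (A y) j / eps j)), m, y; split=> //.
apply: functional_extensionality_dep => j.
rewrite -[LHS]/((@etale_proj L j m%:~R) * (eps j * (m%:~R^-1 * (integers_val (A y) j / eps j)))).
rewrite rmorph_int.
have mj0 : m%:~R != 0 :> etale_field L j.
  by rewrite -(rmorph_int (in_alg (etale_field L j))) fmorph_eq0 intr_eq0.
by rewrite mulrCA mulVKf // mulrC (divfK (A1_unit j)).
Qed.

(** Two fractions for the same [x] are compared over the common denominator [m m']; the additivity
    of [A] then suffices. *)
Lemma quotient_value_inj x t t' : quotient_value x t -> quotient_value x t' -> t = t'.
Proof.
move=> [m [y [m0 yE tE]]] [m' [y' [m'0 y'E t'E]]].
apply: eps_mulI; apply: (@etale_intr_mulI _ (m * m')); first by rewrite mulf_neq0.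
rewrite intrM -[RHS]mulrA t'E [X in X * _ = _]mulrC -mulrA tE -!A_intr_mul.
congr (integers_val (A _)); apply: val_inj.
rewrite rmorphM [RHS]rmorphM !rmorph_int /= yE y'E; exact: mulrCA.
Qed.

Lemma scaled_sub (B : comPzRingType) (a b u v : B) :
  b * (a * u) - a * (b * v) = a * b * (u - v).
Proof. by ring. Qed.

Lemma quotient_valueB x x' t t' : quotient_value x t -> quotient_value x' t' ->
  quotient_value (x - x') (t - t').
Proof.
move=> [m [y [m0 yE tE]]] [m' [y' [m'0 y'E t'E]]].
exists (m * m'), (m'%:~R * y - m%:~R * y'); split; first by rewrite mulf_neq0.
  rewrite -[LHS]/(val (_ - _)) rmorphB rmorphM [X in _ - X]rmorphM !rmorph_int /=.
  rewrite yE y'E intrM; exact: scaled_sub.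
rewrite raddfB -[RHS]/(val (A (m'%:~R * y) - A (m%:~R * y'))) rmorphB /=.
rewrite !A_intr_mul -tE -t'E intrM mulrBr; exact: (esym (scaled_sub _ _ _ _)).
Qed.

Lemma quotient_valueM x x' t t' : quotient_value x t -> quotient_value x' t' ->
  quotient_value (x * x') (t * t').
Proof.
move=> [m [y [m0 yE tE]]] [m' [y' [m'0 y'E t'E]]].
exists (m * m'), (y * y'); split; first by rewrite mulf_neq0.
  by rewrite -[LHS]/(val (_ * _)) rmorphM /= yE y'E intrM mulrACA.
(* The extra factor [A 1] turns the right-hand side into [A y * A y']. *)
apply: eps_mulI; rewrite -[RHS]/(val (A 1 * A (y * y'))) [A 1 * _]mulrC A_mul.
have identity (B : comPzRingType) (e a b u v : B) :
  e * (a * b * (e * (u * v))) = a * (e * u) * (b * (e * v)) by ring.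
rewrite [RHS]rmorphM /= -tE -t'E intrM; exact: identity.
Qed.

Lemma quotient_value1 : quotient_value 1 1.
Proof. by exists 1, 1; split=> //; rewrite mulr1 // mul1r. Qed.

Lemma quotient_valueZ (c : rat) x t : quotient_value x t -> quotient_value (c *: x) (c *: t).
Proof.
move=> [m [y [m0 yE tE]]].
have cE (M : etale) (u : M) : (denq c)%:~R * (c *: u) = (numq c)%:~R * u.
  by rewrite !mulrzl -!scaler_int scalerA mulrC -numqE.
exists (denq c * m), ((numq c)%:~R * y); split.
- by rewrite mulf_neq0 // denq_neq0.
- rewrite -[LHS]/(val (_ * _)) rmorphM rmorph_int /= yE intrM.
  by rewrite [_ * m%:~R]mulrC -mulrA cE mulrCA.
by rewrite A_intr_mul -tE intrM [_ * m%:~R]mulrC -mulrA -scalerAr cE mulrCA.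
Qed.

(** The relation [quotient_value] is total and single-valued, so it defines [tau], and its
    compatibility with each operation becomes a morphism law. *)
Lemma twisted_hom : exists tau : {lrmorphism K -> L},
  forall x : integers K, integers_val (A x) = eps * tau (integers_val x).
Proof.
have /boolp.choice [tau tauP] := quotient_value_exists.
have tauE x t : quotient_value x t -> tau x = t by exact: quotient_value_inj (tauP x).
have tauB : zmod_morphism tau by move=> x y; apply: tauE; exact: quotient_valueB.
have tauM : monoid_morphism tau.
  split=> [|x y]; apply: tauE; [exact: quotient_value1 | exact: quotient_valueM].
have tauZ : scalable tau by move=> c x; apply: tauE; exact: quotient_valueZ.
pose T : {lrmorphism K -> L} := HB.pack tau
  (GRing.isZmodMorphism.Build K L tau tauB)
  (GRing.isMonoidMorphism.Build K L tau tauM)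
  (GRing.isScalable.Build rat K L *:%R tau tauZ).
exists T => x; rewrite -[T _]/(tau (integers_val x)).
have [m [y [m0 yE tE]]] := tauP (integers_val x).
apply: (etale_intr_mulI m0); rewrite tE -A_intr_mul.
congr (integers_val (A _)); apply: val_inj.
by rewrite rmorphM rmorph_int /= yE.
Qed.
End HomFromIntegers.

Theorem theorem4p1 (RT : realType) (K L : etale) (R : sieve K) (S : sieve L)
  (meas : forall P : prime_of K, probability (borel_completion P) RT)
  (meas_haar : forall P : prime_of K, haar (meas P))
  (A : {additive integers K -> integers L})
  (infinitely_many_p : infinite_set [set p : prime_number |
     [/\ p_map p A @` unsieved R p `<=` unsieved S p,
         forall Q : prime_of L, lies_above p Q ->
           [set completion_of Q (A a) | a in setT] `&` S Q !=set0,
         (\esum_(P in [set P : prime_of K | lies_above p P]) meas P (R P)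
            < 1)%E
       & splits_completely K p /\ splits_completely L p]]) :
  exists (tau : {lrmorphism K -> L}) (eps : integers L),
    forall x : integers K, integers_val (A x) = integers_val eps * tau (integers_val x).
Proof.
have A_mul x y : A (x * y) * A 1 = A x * A y.
  apply/eqP; rewrite -subr_eq0; apply/eqP/integers_eq0 => n.
  have [p [hA hS hm [hK hL]] np] := infinite_primes_gt n infinitely_many_p.
  exists p; split=> // Q pQ.
  exact: (good_prime_mul meas_haar hA hS hm hK hL x y pQ).
have [p [hA hS hm [hK hL]] _] := infinite_primes_gt 0 infinitely_many_p.
have A1_unit j : integers_val (A 1) j != 0.
  (* If [A 1] vanishes in the component [j], multiplicativity at [(x, x)] makes the square of the
     component of [A x] vanish for every [x]. *)
  apply/eqP => A10; apply: (good_prime_unit meas_haar hA hS hm hK hL (j := j)) => x.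
  have := congr1 (fun z : integers L => integers_val z j) (A_mul x x).
  rewrite -[LHS]/(integers_val (A (x * x)) j * integers_val (A 1) j) A10 mulr0.
  rewrite -[RHS]/(integers_val (A x) j * integers_val (A x) j).
  by move=> /esym/eqP; rewrite mulf_eq0 orbb => /eqP.
have [s sP] := splits_completely_embeddings hK.
have [tau tauE] := twisted_hom A_mul A1_unit (integral_multiple_exists sP).
by exists tau, (A 1).
Qed.
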